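(* Assume $\mathbb Q\subseteq\Bbbk$. For each $\mathbf v\in\mathbb N^I$, the algebra $\mathcal A(\mathbf v)[M^{-1}]$ is spherically generated with respect to its $\mathbb N^I$-grading. More precisely, it is generated over $R[M^{-1}]$ by the elements $Q_i^{(r)},F_i^{(r)}$ for $i\in I$ and $r\ge1$. Moreover, for each $\mathbf m\in\mathbb N^I$ there exists an element $h_{\mathbf m}\in M$, independent of $\mathbf v$, such that $h_{\mathbf m}\cdot\mathsf M_{\mathbf m}(f)=\mathsf M_{\mathbf m}(h_{\mathbf m}f)$ is inside the spherical subalgebra of $\mathcal A(\mathbf v)$ for all $\mathbf v\ge\mathbf m$ and all $f\in\Lambda^{(1^{\mathbf m})}(\mathbf v)$; that is, $\mathsf M_{\mathbf m}(h_{\mathbf m}f)$ is expressible over $R$ in terms of the elements $Q_i^{(r)},F_i^{(r)}$.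
   Context: Conventions. $\Bbbk$ is a commutative ring, $\mathbb N=\{0,1,2,\dots\}$, $[n]=\{1,\dots,n\}$. $Q=(I,E)$ is a finite quiver (edge loops and multiple edges allowed) with source and target maps $\mathsf s,\mathsf t:E\to I$. $\{\alpha_i\}_{i\in I}$ is the standard basis of $\mathbb Z^I$. On $\mathbb Z^I$, $\mathbf v'\le\mathbf v$ means $v'_i\le v_i$ for all $i$. $R=\Bbbk[\tfrac12\hbar,\theta_e:e\in E]$ is a polynomial ring in variables $\tfrac12\hbar,\theta_e$. An $\mathbb N^I$-graded algebra $B$ is spherically generated if it is generated by its homogeneous components $B_{\mathbf 0}$ and $B_{\alpha_i}$, $i\in I$; its spherical subalgebra is the subalgebra generated by these components. The multiplicative set $M$. Let $\overline Q=(I,E\sqcup E^{op})$ be the doubled quiver, with an opposite arrow $\overline e\in E^{op}$ for each $e\in E$ (source and target swapped). Put $\theta_h=\theta_e$ if $h=e\in E$ and $\theta_h=-\theta_e$ if $h=\overline e\in E^{op}$. For a closed path $p=(h_1,\dots,h_\ell)$ in $\overline Q$ (so $\mathsf t(h_n)=\mathsf s(h_{n+1})$ for $1\le n<\ell$ and $\mathsf t(h_\ell)=\mathsf s(h_1)$) put $y_p=\theta_{h_1}+\dots+\theta_{h_\ell}-\tfrac\ell2\hbar\in R$. $M\subset R$ is the multiplicative set generated by all $y_p$. Difference operators. For $\mathbf v=(v_i)\in\mathbb N^I$ let $\widetilde\Lambda(\mathbf v)=R[w_{i,r}:i\in I,r\in[v_i]]$, on which $S_{\mathbf v}=\prod_iS_{v_i}$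 acts by permuting the $w_{i,r}$ for each $i$, and $\Lambda(\mathbf v)=\widetilde\Lambda(\mathbf v)^{S_{\mathbf v}}$. Let $\widetilde A(\mathbf v)$ be the $R$-algebra generated by $w_{i,r},u_{i,r}$ with relations $u_{i,r}w_{j,s}=(w_{j,s}+\hbar\delta_{ij}\delta_{rs})u_{i,r}$, $[u_{i,r},u_{j,s}]=[w_{i,r},w_{j,s}]=0$, and $\widetilde A(\mathbf v)_{loc}$ its Ore localization at the multiplicative set generated by $w_{i,r}-w_{i,s}+n\hbar$ ($r\ne s$, $n\in\mathbb Z$). Quantized zastava. $\mathcal A(\mathbf v)$ is the Braverman–Finkelberg–Nakajima algebra $H_\bullet^{(\mathbf G_{\mathcal O}\rtimes\mathbb C^\times)\times\mathbf F}(\mathcal R^+_{\mathbf G,\mathbf N},\Bbbk)$ for $\mathbf G=\prod_i\mathbf{GL}_{v_i}$, $\mathbf N=\bigoplus_{e}\mathrm{Hom}(\mathbb C^{v_{\mathsf s(e)}},\mathbb C^{v_{\mathsf t(e)}})$, $\mathbf F=\prod_{e}\mathbb C^\times$; by known results it is identified with the following subring of $\widetilde A(\mathbf v)_{loc}^{S_{\mathbf v}}$, which may be taken as its definition. For $\mathbf 0\le\mathbf m\le\mathbf v$ let $\Lambda^{(1^{\mathbf m})}(\mathbf v)=\widetilde\Lambda(\mathbf v)^{S_{\mathbf m}\times S_{\mathbf v-\mathbf m}}$, where $S_{\mathbf m}\times S_{\mathbf v-\mathbf m}\subseteq S_{\mathbf v}$ is the subgroup preserving each $[m_i]\subseteq[v_i]$.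 For $f\in\Lambda^{(1^{\mathbf m})}(\mathbf v)$ the fundamental monopole operator is $$\mathsf M_{\mathbf m}(f)=\sum_{\Gamma}f|_\Gamma\cdot\frac{\prod_{e\in E}\prod_{r\in\Gamma_{\mathsf s(e)},\,s\in[v_{\mathsf t(e)}]\setminus\Gamma_{\mathsf t(e)}}(w_{\mathsf t(e),s}-w_{\mathsf s(e),r}+\theta_e-\tfrac12\hbar)}{\prod_{i\in I}\prod_{r\in\Gamma_i,\,s\in[v_i]\setminus\Gamma_i}(w_{i,r}-w_{i,s})}\prod_{i\in I}\prod_{r\in\Gamma_i}u_{i,r},$$ sum over tuples $\Gamma=(\Gamma_i)_{i\in I}$, $\Gamma_i\subseteq[v_i]$, $\#\Gamma_i=m_i$, with $f|_\Gamma=\sigma(f)$ for any $\sigma\in S_{\mathbf v}$ with $\sigma_i([m_i])=\Gamma_i$. $\mathcal A(\mathbf v)$ is the subring generated by all $\mathsf M_{\mathbf m}(f)$ (with $\mathsf M_{\mathbf 0}(f)=f$). $R$ is central in it, and it is $\mathbb N^I$-graded with $\mathsf M_{\mathbf m}(f)$ in degree $\mathbf m$ (equivalently $u_{i,r}$ in degree $\alpha_i$, and $w_{i,r}$, $R$ in degree $\mathbf 0$). Elements. $Q_i^{(r)}\in\Lambda(\mathbf v)$ is defined by $\sum_{r\ge0}Q_i^{(r)}z^{-r}=\prod_{s=1}^{v_i}(1-z^{-1}w_{i,s})$, and $F_i^{(r)}=\mathsf M_{\alpha_i}(w_{i,1}^{r-1})$ for $r\ge1$ (i.e. $\sum_{r\ge1}F_i^{(r)}z^{-r}=\mathsf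 M_{\alpha_i}\big(\tfrac1{z-w_{i,1}}\big)$), with $F_i^{(r)}=0$ if $v_i=0$. *)

(* Defs.v *)
From HB Require Import structures.
From mathcomp Require Import all_boot all_order all_algebra.
From mathcomp Require Import perm generic_quotient finmap.
From mathcomp Require Import boolp classical_sets.
From mathcomp Require Import mpoly monalg.

Set Implicit Arguments.
Unset Strict Implicit.
Unset Printing Implicit Defensive.

Import GRing.Theory.
Local Open Scope classical_set_scope.
Local Open Scope quotient_scope.
Local Open Scope ring_scope.

Inductive mult_gen (A : pzRingType) (X : set A) : set A :=
| mult_gen1 : mult_gen X 1
| mult_gen_in x : X x -> mult_gen X x
| mult_genM x y : mult_gen X x -> mult_gen X y -> mult_gen X (x * y).

Inductive subring_gen (A : pzRingType) (X : set A) : set A :=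
| subring_gen1 : subring_gen X 1
| subring_gen_in x : X x -> subring_gen X x
| subring_genB x y : subring_gen X x -> subring_gen X y -> subring_gen X (x - y)
| subring_genM x y : subring_gen X x -> subring_gen X y -> subring_gen X (x * y).

(* Localization of a ring, not necessarily commutative, at a multiplicative
   set of central elements. Zero divisors are allowed: a / s = b / t iff
   u t a = u s b for some u in the set. *)
Record central_multset (A : pzRingType) := CentralMultset {
  cms_set :> set A;
  cms1 : cms_set 1;
  cmsM : forall s t, cms_set s -> cms_set t -> cms_set (s * t);
  cms_central : forall s x, cms_set s -> s * x = x * s }.

Section Localization.
Variables (A : pzRingType) (S : central_multset A).
Implicit Types (a b c x y : A) (s t u r : S).

Let inS s : cms_set S (val s) := set_valP s.

Definition den1 : S := SigSub (mem_set (cms1 S)).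
Definition denM s t : S := SigSub (mem_set (cmsM (inS s) (inS t))).

Definition loc_equiv (p q : A * S) : bool :=
  `[< exists u : S, val u * (val q.2 * p.1) = val u * (val p.2 * q.1) >].

Let denC s x : val s * x = x * val s := cms_central x (inS s).
Let denCA s x y : x * (val s * y) = val s * (x * y).
Proof. by rewrite mulrA -denC mulrA. Qed.
Let denAC s x y : x * val s * y = val s * (x * y).
Proof. by rewrite -denC mulrA. Qed.

Lemma loc_equiv_refl : reflexive loc_equiv.
Proof. by move=> p; apply/asboolP; exists den1. Qed.

Lemma loc_equiv_sym : ssrbool.symmetric loc_equiv.
Proof.
by move=> p q; apply/asboolP/asboolP => -[u h]; exists u; rewrite h.
Qed.

Lemma loc_equiv_trans : transitive loc_equiv.
Proof.
move=> [b t] [a s] [c r] /asboolP[/= u h1] /asboolP[/= w h2].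
apply/asboolP; exists (denM t (denM u w)) => /=.
have e1 : val t * (val u * val w) * (val r * a)
    = val w * val r * (val u * (val t * a)).
  by rewrite -!mulrA ?(denCA u) ?(denCA t) ?(denCA w).
have e2 : val t * (val u * val w) * (val s * c)
    = val u * val s * (val w * (val t * c)).
  by rewrite -!mulrA ?(denCA u) ?(denCA t) ?(denCA w) ?(denCA s).
rewrite e1 e2 h1 -h2.
by rewrite -!mulrA ?(denCA u) ?(denCA s) ?(denCA w).
Qed.

Canonical loc_equivRel :=
  EquivRel loc_equiv loc_equiv_refl loc_equiv_sym loc_equiv_trans.

Definition loc := {eq_quot loc_equiv}.
HB.instance Definition _ : EqQuotient _ loc_equiv loc := EqQuotient.on loc.
HB.instance Definition _ := Choice.on loc.

Definition frac a s : loc := \pi_loc (a, s).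

Lemma fracP a s b t :
  (exists u : S, val u * (val t * a) = val u * (val s * b)) <->
  frac a s = frac b t.
Proof.
split=> [h|/eqP]; first by apply/eqmodP/asboolP.
by rewrite eqmodE => /asboolP.
Qed.

Lemma frac_surj (x : loc) : exists a s, x = frac a s.
Proof. by elim/quotW: x => -[a s]; exists a, s. Qed.

Lemma frac_scale u a s : frac (val u * a) (denM u s) = frac a s.
Proof. by apply/fracP; exists den1 => /=; rewrite !mul1r denCA mulrA. Qed.

Let add_pre (p q : A * S) : A * S :=
  (val q.2 * p.1 + val p.2 * q.1, denM p.2 q.2).
Let mul_pre (p q : A * S) : A * S := (p.1 * q.1, denM p.2 q.2).

Definition loc_add (x y : loc) : loc := \pi_loc (add_pre (repr x) (repr y)).
Definition loc_mul (x y : loc) : loc := \pi_loc (mul_pre (repr x) (repr y)).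
Definition loc_opp (x : loc) : loc := \pi_loc (- (repr x).1, (repr x).2).

Let repr_frac a s : exists u : S,
  val u * (val s * (repr (frac a s)).1) = val u * (val (repr (frac a s)).2 * a).
Proof.
apply/(fracP (repr (frac a s)).1 (repr (frac a s)).2 a s).
by rewrite -[RHS]reprK /frac; case: (repr _).
Qed.

Let addfE a s b t :
  loc_add (frac a s) (frac b t) = frac (val t * a + val s * b) (denM s t).
Proof.
rewrite /loc_add /add_pre.
have [u] := repr_frac a s; have [w] := repr_frac b t.
case: (repr (frac a s)) => a' s' /=; case: (repr (frac b t)) => b' t' /= h2 h1.
apply/fracP; exists (denM u w) => /=; rewrite !mulrDr; congr (_ + _).
  have -> : val u * val w * (val s * val t * (val t' * a'))
      = val w * val t * val t' * (val u * (val s * a')).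
    by rewrite -!mulrA ?(denCA u) ?(denCA t) ?(denCA w) ?(denCA t') ?(denCA s).
  rewrite h1.
  by rewrite -!mulrA ?(denCA u) ?(denCA t) ?(denCA w) ?(denCA t') ?(denCA s').
have -> : val u * val w * (val s * val t * (val s' * b'))
    = val u * val s * val s' * (val w * (val t * b')).
  by rewrite -!mulrA ?(denCA u) ?(denCA t) ?(denCA w) ?(denCA s') ?(denCA s).
rewrite h2.
by rewrite -!mulrA ?(denCA u) ?(denCA s) ?(denCA w) ?(denCA t') ?(denCA s').
Qed.

Let mulfE a s b t : loc_mul (frac a s) (frac b t) = frac (a * b) (denM s t).
Proof.
rewrite /loc_mul /mul_pre.
have [u] := repr_frac a s; have [w] := repr_frac b t.
case: (repr (frac a s)) => a' s' /=; case: (repr (frac b t)) => b' t' /= h2 h1.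
apply/fracP; exists (denM u w) => /=.
have -> : val u * val w * (val s * val t * (a' * b'))
    = (val u * (val s * a')) * (val w * (val t * b')).
  by rewrite -!mulrA ?(denCA u) ?(denCA w) ?(denCA s) ?(denCA t).
rewrite h1 h2.
by rewrite -!mulrA ?(denCA u) ?(denCA w) ?(denCA s') ?(denCA t').
Qed.

Let oppfE a s : loc_opp (frac a s) = frac (- a) s.
Proof.
rewrite /loc_opp; have [u] := repr_frac a s.
case: (repr (frac a s)) => a' s' /= h1.
by apply/fracP; exists u => /=; rewrite !mulrN h1.
Qed.

Lemma frac_common (x y z : loc) :
  exists a b c s, [/\ x = frac a s, y = frac b s & z = frac c s].
Proof.
have [a [s ->]] := frac_surj x; have [b [t ->]] := frac_surj y.
have [c [r ->]] := frac_surj z.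
exists (val t * val r * a), (val s * val r * b), (val s * val t * c).
exists (denM s (denM t r)); split; apply/fracP; exists den1 => /=; rewrite !mul1r.
- by rewrite -!mulrA ?(denCA s) ?(denCA t) ?(denCA r).
- by rewrite -!mulrA ?(denCA t) ?(denCA s) ?(denCA r).
- by rewrite -!mulrA ?(denCA r) ?(denCA s) ?(denCA t).
Qed.

Let addf_common a b s : loc_add (frac a s) (frac b s) = frac (a + b) s.
Proof. by rewrite addfE -mulrDr frac_scale. Qed.

Let loc_addA : associative loc_add.
Proof.
move=> x y z; have [a [b [c [s [-> -> ->]]]]] := frac_common x y z.
by rewrite !addf_common addrA.
Qed.
Let loc_addC : commutative loc_add.
Proof.
move=> x y; have [a [b [c [s [-> -> _]]]]] := frac_common x y x.
by rewrite !addf_common addrC.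
Qed.
Let loc_add0 : left_id (frac 0 den1) loc_add.
Proof.
move=> x; have [a [s ->]] := frac_surj x; rewrite addfE mulr0 add0r.
exact: frac_scale.
Qed.
Let loc_addN : left_inverse (frac 0 den1) loc_opp loc_add.
Proof.
move=> x; have [a [s ->]] := frac_surj x.
rewrite oppfE addf_common addNr; apply/fracP; exists den1.
by rewrite !mulr0.
Qed.

HB.instance Definition _ :=
  GRing.isZmodule.Build loc loc_addA loc_addC loc_add0 loc_addN.

Let loc_mulA : associative loc_mul.
Proof.
move=> x y z; have [a [s ->]] := frac_surj x; have [b [t ->]] := frac_surj y.
have [c [r ->]] := frac_surj z; rewrite !mulfE mulrA.
by congr frac; apply: val_inj; rewrite /= mulrA.
Qed.
Let loc_mul1 : left_id (frac 1 den1) loc_mul.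
Proof.
move=> x; have [a [s ->]] := frac_surj x; rewrite mulfE mul1r.
by congr frac; apply: val_inj; rewrite /= mul1r.
Qed.
Let loc_mulr1 : right_id (frac 1 den1) loc_mul.
Proof.
move=> x; have [a [s ->]] := frac_surj x; rewrite mulfE mulr1.
by congr frac; apply: val_inj; rewrite /= mulr1.
Qed.
Let loc_mulDl : left_distributive loc_mul loc_add.
Proof.
move=> x y z; have [a [b [c [s [-> -> ->]]]]] := frac_common x y z.
by rewrite addf_common !mulfE addf_common mulrDl.
Qed.
Let loc_mulDr : right_distributive loc_mul loc_add.
Proof.
move=> x y z; have [a [b [c [s [-> -> ->]]]]] := frac_common x y z.
by rewrite addf_common !mulfE addf_common mulrDr.
Qed.

HB.instance Definition _ := GRing.Zmodule_isPzRing.Build loc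
  loc_mulA loc_mul1 loc_mulr1 loc_mulDl loc_mulDr.

Lemma fracD a s b t :
  frac a s + frac b t = frac (val t * a + val s * b) (denM s t).
Proof. exact: addfE. Qed.
Lemma fracN a s : - frac a s = frac (- a) s.
Proof. exact: oppfE. Qed.
Lemma fracM a s b t : frac a s * frac b t = frac (a * b) (denM s t).
Proof. exact: mulfE. Qed.

Definition to_loc a : loc := frac a den1.

Lemma to_loc_zmod : zmod_morphism to_loc.
Proof. by move=> a b; rewrite /to_loc fracN; exact/esym/addf_common. Qed.
Lemma to_loc_monoid : monoid_morphism to_loc.
Proof.
split=> // a b; rewrite /to_loc fracM; congr frac; apply: val_inj.
by rewrite /= mulr1.
Qed.
HB.instance Definition _ := GRing.isZmodMorphism.Build A loc to_loc to_loc_zmod.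
HB.instance Definition _ :=
  GRing.isMonoidMorphism.Build A loc to_loc to_loc_monoid.

(* B[S^-1], for a subgroup B of A stable under S, embeds in A[S^-1] as the set
   of fractions with numerator in B. *)
Definition loc_set (B : set A) : set loc :=
  [set x | exists a s, B a /\ x = frac a s].

End Localization.
Arguments loc_set {A} S B.

Section ComLocalization.
Variables (A : comPzRingType) (S : central_multset A).

Lemma loc_mulC : commutative (@GRing.mul (loc S)).
Proof.
move=> x y; have [a [s ->]] := frac_surj x; have [b [t ->]] := frac_surj y.
by rewrite !fracM mulrC; congr frac; apply: val_inj; rewrite /= mulrC.
Qed.
HB.instance Definition _ :=
  GRing.PzRing_hasCommutativeMul.Build (loc S) loc_mulC.

Definition com_multset (X : set A) : central_multset A :=
  CentralMultset (mult_gen1 X) (@mult_genM _ X) (fun s x _ => mulrC s x).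

Variables (f : {rmorphism A -> A}) (fS : forall s, cms_set S s -> cms_set S (f s)).

Definition map_den (s : S) : S := SigSub (mem_set (fS (set_valP s))).
Definition loc_map (x : loc S) : loc S :=
  frac (f (repr x).1) (map_den (repr x).2).

Lemma loc_mapE a (s : S) :
  loc_map (frac a s) = frac (f a) (map_den s).
Proof.
rewrite /loc_map.
have: frac (repr (frac a s)).1 (repr (frac a s)).2 = frac a s.
  by rewrite -[RHS]reprK /frac; case: (repr _).
case: (repr (frac a s)) => a' s' /= /fracP[u h]; apply/fracP.
exists (map_den u) => /=.
by rewrite -!rmorphM h.
Qed.

Lemma loc_map_zmod : zmod_morphism loc_map.
Proof.
move=> x y; have [a [s ->]] := frac_surj x; have [b [t ->]] := frac_surj y.
rewrite fracN fracD !loc_mapE fracN fracD /= rmorphD !rmorphM rmorphN.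
by congr frac; apply: val_inj; rewrite /= rmorphM.
Qed.
Lemma loc_map_monoid : monoid_morphism loc_map.
Proof.
split=> [|x y].
  have -> : (1 : loc S) = frac 1 (den1 S) by [].
  by rewrite loc_mapE rmorph1; congr frac; apply: val_inj; rewrite /= rmorph1.
have [a [s ->]] := frac_surj x; have [b [t ->]] := frac_surj y.
rewrite fracM !loc_mapE fracM rmorphM.
by congr frac; apply: val_inj; rewrite /= rmorphM.
Qed.
HB.instance Definition _ :=
  GRing.isZmodMorphism.Build (loc S) (loc S) loc_map loc_map_zmod.
HB.instance Definition _ :=
  GRing.isMonoidMorphism.Build (loc S) (loc S) loc_map loc_map_monoid.

End ComLocalization.

(* Skew monoid ring of an action tau of an additive commutative monoid N on a
   ring K by endomorphisms: finite sums of terms << x *g a >>, written x u^a,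
   with u^a x = tau_a(x) u^a and u^a u^b = u^(a+b). *)
Record mon_action (N : nmodType) (K : pzRingType) := MonAction {
  mon_act :> N -> {rmorphism K -> K};
  mon_act0 : forall x, mon_act 0 x = x;
  mon_actD : forall a b x, mon_act (a + b) x = mon_act a (mon_act b x) }.

Definition skew (N : nmodType) (K : pzRingType) (tau : mon_action N K) : Type :=
  {malg K[N]}.

Section Skew.
Variables (N : nmodType) (K : pzRingType) (tau : mon_action N K).
Local Notation skew := (skew tau).

HB.instance Definition _ := GRing.Zmodule.on skew.
Implicit Types g : skew.

Definition skew_mul g1 g2 : skew :=
  \sum_(a <- msupp g1) \sum_(b <- msupp g2)
    << mcoeff a g1 * tau a (mcoeff b g2) *g a + b >>.
Definition skew1 : skew := << 1 *g 0 >>.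

Let skew_mulw (d1 d2 : {fset N}) g1 g2 :
  fsubset (msupp g1) d1 -> fsubset (msupp g2) d2 ->
  skew_mul g1 g2 =
  \sum_(a <- d1) \sum_(b <- d2) << mcoeff a g1 * tau a (mcoeff b g2) *g a + b >>.
Proof.
move=> le1 le2; rewrite /skew_mul (big_fset_incl _ le1) /=.
  apply/eq_bigr => a _; apply/big_fset_incl => // b _ /mcoeff_outdom ->.
  by rewrite rmorph0 mulr0 monalgU0.
by move=> a _ /mcoeff_outdom e; rewrite big1 // => b _; rewrite e mul0r monalgU0.
Qed.

Lemma skew_mulUU x y a b :
  skew_mul << x *g a >> << y *g b >> = << x * tau a y *g a + b >>.
Proof.
by rewrite (skew_mulw msuppU_le msuppU_le) !big_seq_fset1 !mcoeffUU.
Qed.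

Let skew_mulDl : left_distributive skew_mul +%R.
Proof.
move=> g1 g2 g; have s x := fsubset_refl (msupp (x : skew)).
rewrite (skew_mulw (msuppD_le _ _) (s g)) (skew_mulw (fsubsetUl _ (msupp g2)) (s g)).
rewrite (skew_mulw (fsubsetUr (msupp g1) _) (s g)) -big_split /=.
apply/eq_bigr => a _; rewrite -big_split /=; apply/eq_bigr => b _.
by rewrite mcoeffD mulrDl monalgUD.
Qed.
Let skew_mulDr : right_distributive skew_mul +%R.
Proof.
move=> g g1 g2; have s x := fsubset_refl (msupp (x : skew)).
rewrite (skew_mulw (s g) (msuppD_le _ _)) (skew_mulw (s g) (fsubsetUl _ (msupp g2))).
rewrite (skew_mulw (s g) (fsubsetUr (msupp g1) _)) -big_split /=.
apply/eq_bigr => a _; rewrite -big_split /=; apply/eq_bigr => b _.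
by rewrite mcoeffD rmorphD mulrDr monalgUD.
Qed.
Let skew_mul0 g : skew_mul 0 g = 0.
Proof. by rewrite /skew_mul msupp0 big_seq_fset0. Qed.
Let skew_mulr0 g : skew_mul g 0 = 0.
Proof. by rewrite /skew_mul big1 // => a _; rewrite msupp0 big_seq_fset0. Qed.

Let skew_ind (P : skew -> Prop) :
  P 0 -> (forall g1 g2, P g1 -> P g2 -> P (g1 + g2)) ->
  (forall x a, P << x *g a >>) -> forall g, P g.
Proof. by move=> P0 PD PU g; rewrite [g]monalgE; apply: big_ind. Qed.

Let skew_mulA : associative skew_mul.
Proof.
move=> g1 g2 g3; elim/skew_ind: g1 => [|g g' h h'|x a].
- by rewrite !skew_mul0.
- by rewrite !skew_mulDl h h'.
elim/skew_ind: g2 => [|g g' h h'|y b].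
- by rewrite !(skew_mul0, skew_mulr0).
- by rewrite !(skew_mulDl, skew_mulDr) h h'.
elim/skew_ind: g3 => [|g g' h h'|z c].
- by rewrite !skew_mulr0.
- by rewrite !skew_mulDr h h'.
by rewrite !skew_mulUU rmorphM mon_actD mulrA addrA.
Qed.
Let skew_mul1 : left_id skew1 skew_mul.
Proof.
elim/skew_ind => [|g g' h h'|x a]; rewrite ?skew_mulr0 ?skew_mulDr ?h ?h' //.
by rewrite skew_mulUU mul1r add0r mon_act0.
Qed.
Let skew_mulr1 : right_id skew1 skew_mul.
Proof.
elim/skew_ind => [|g g' h h'|x a]; rewrite ?skew_mul0 ?skew_mulDl ?h ?h' //.
by rewrite skew_mulUU rmorph1 mulr1 addr0.
Qed.

HB.instance Definition _ := GRing.Zmodule_isPzRing.Build skew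
  skew_mulA skew_mul1 skew_mulr1 skew_mulDl skew_mulDr.

Lemma skewMUU x y a b :
  (<< x *g a >> : skew) * << y *g b >> = << x * tau a y *g a + b >>.
Proof. exact: skew_mulUU. Qed.

Lemma skew_central x :
  (forall y, x * y = y * x) -> (forall a, tau a x = x) ->
  forall g, (<< x *g 0 >> : skew) * g = g * << x *g 0 >>.
Proof.
move=> xC xT; elim/skew_ind => [|g g' h h'|y a].
- by rewrite mulr0 mul0r.
- by rewrite mulrDr mulrDl h h'.
by rewrite !skewMUU mon_act0 xT xC addrC.
Qed.

End Skew.

(* The polynomial ring over R in variables indexed by a finite type T. *)
Section PolyRing.
Variables (R : comNzRingType) (T : finType).

Definition pring := {mpoly R[#|T|]}.
HB.instance Definition _ := GRing.ComNzRing.on pring.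

Definition pvar (t : T) : pring := 'X_(enum_rank t).
Definition pconst (c : R) : pring := mpolyC _ c.

Lemma pconst_zmod : zmod_morphism pconst.
Proof. exact: mpoly.mpolyCB. Qed.
Lemma pconst_monoid : monoid_morphism pconst.
Proof. by split=> [|c d]; [exact: mpoly.mpolyC1|exact: mpoly.mpolyCM]. Qed.
HB.instance Definition _ := GRing.isZmodMorphism.Build R pring pconst pconst_zmod.
HB.instance Definition _ :=
  GRing.isMonoidMorphism.Build R pring pconst pconst_monoid.

(* The R-algebra endomorphism sending the variable t to F t. *)
Definition psubst (F : T -> pring) (p : pring) : pring :=
  p \mPo [tuple F (enum_val i) | i < #|T|].

Section Morphism.
Variable F : T -> pring.
Lemma psubst_zmod : zmod_morphism (psubst F).
Proof. by move=> p q; rewrite /psubst [LHS]raddfB. Qed.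
Lemma psubst_monoid : monoid_morphism (psubst F).
Proof.
by split=> [|p q]; rewrite /psubst; [rewrite [LHS]rmorph1|rewrite [LHS]rmorphM].
Qed.
HB.instance Definition _ :=
  GRing.isZmodMorphism.Build pring pring (psubst F) psubst_zmod.
HB.instance Definition _ :=
  GRing.isMonoidMorphism.Build pring pring (psubst F) psubst_monoid.
End Morphism.

Lemma psubst_var F t : psubst F (pvar t) = F t.
Proof.
by rewrite /psubst /pvar comp_mpolyXU -tnth_nth tnth_mktuple enum_rankK.
Qed.
Lemma psubst_const F c : psubst F (pconst c) = pconst c.
Proof. exact: comp_mpolyC. Qed.

Lemma pring_ind (P : pring -> Prop) :
  (forall c, P (pconst c)) -> (forall t, P (pvar t)) ->
  (forall p q, P p -> P q -> P (p + q)) ->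
  (forall p q, P p -> P q -> P (p * q)) -> forall p, P p.
Proof.
move=> PC Pw PD PM; elim/mpolyind => [|c m p _ _ Pp].
  by have := PC 0; rewrite rmorph0.
apply: PD => //; rewrite -mul_mpolyC; apply: (PM); first exact: PC.
have P1 : P 1 by have := PC 1; rewrite rmorph1.
rewrite mpolyXE_id; apply: big_ind => [//|q r|i _]; first exact: (PM).
have -> : 'X_i = pvar (enum_val i) by rewrite /pvar enum_valK.
by elim: (m _) => [|n IH]; rewrite ?expr0 // exprS; apply: PM.
Qed.

Lemma psubst_comp F G p :
  psubst F (psubst G p) = psubst (fun t => psubst F (G t)) p.
Proof.
elim/pring_ind: p => [c|t|p q hp hq|p q hp hq].
- by rewrite !psubst_const.
- by rewrite !psubst_var.
- by rewrite !rmorphD /= hp hq.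
by rewrite !rmorphM /= hp hq.
Qed.
End PolyRing.

Record quiver := Quiver {
  vertex : finType;
  arrow : finType;
  src : arrow -> vertex;
  tgt : arrow -> vertex }.

Section Quiver.
Variables (k : comNzRingType) (Q : quiver).
Local Notation I := (vertex Q).
Local Notation E := (arrow Q).

(* R = k[hbar/2, theta_e]: the variable None is hbar/2, Some e is theta_e. *)
Definition base_ring : comNzRingType := pring k (option E).
Local Notation R := base_ring.

Definition half_hbar : R := pvar k (None : option E).
Definition hbar : R := half_hbar *+ 2.
Definition theta (e : E) : R := pvar k (Some e).

(* Arrows of the doubled quiver: inl e is e, inr e is its opposite. *)
Definition dsrc (h : E + E) : I :=
  match h with inl e => src e | inr e => tgt e end.
Definition dtgt (h : E + E) : I :=
  match h with inl e => tgt e | inr e => src e end.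
Definition dtheta (h : E + E) : R :=
  match h with inl e => theta e | inr e => - theta e end.

Definition closed_path (p : seq (E + E)) : bool :=
  (p != [::]) && cycle (fun h h' => dtgt h == dsrc h') p.
Definition y_path (p : seq (E + E)) : R :=
  \sum_(h <- p) dtheta h - half_hbar *+ size p.
Definition Mset : set R :=
  mult_gen [set y | exists2 p, closed_path p & y = y_path p].

Definition alpha (i : I) : I -> nat := fun j => (j == i) : nat.

Definition spherical_subalgebra (B : pzRingType) (comp : (I -> nat) -> set B) :
    set B :=
  subring_gen (comp (fun=> 0%N) `|` \bigcup_i comp (alpha i)).

Definition spherically_generated (B : pzRingType) (A : set B)
    (comp : (I -> nat) -> set B) : Prop :=
  A = spherical_subalgebra comp.

Section Zastava.
Variable v : I -> nat.

(* Pairs (i, r) with r in [v_i]; r is 0-based. *)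
Definition windex : finType := {i : I & 'I_(v i)}.
Local Notation J := windex.

Local Notation wpoly := (pring R J).
Local Notation w := (@pvar R J).
Local Notation cst := (@pconst R J).

(* S_v, as the permutations of J preserving the vertex. *)
Definition in_Sv (s : {perm J}) : bool := [forall j, tag (s j) == tag j].
Definition permw (s : {perm J}) : wpoly -> wpoly := psubst (fun j => w (s j)).

(* The tuple of the subsets [m_i] of [v_i]. *)
Definition corner (m : I -> nat) : {set J} :=
  [set j : J | (tagged j < m (tag j))%N]%SET.

Definition Lambda1 (m : I -> nat) : set wpoly :=
  [set f | forall s, in_Sv s -> s @: corner m = corner m -> permw s f = f].

(* A tuple of subsets of the [v_i] is a subset G of J. *)
Definition has_size (m : I -> nat) (G : {set J}) : bool :=
  [forall i, #|[set j in G | tag j == i]%SET| == m i].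

(* The value 0 is never taken if m <= v and has_size m G. *)
Definition restr (m : I -> nat) (f : wpoly) (G : {set J}) : wpoly :=
  if [pick s : {perm J} | in_Sv s && (s @: corner m == G)] is Some s
  then permw s f else 0.

Lemma restrE m f s :
  Lambda1 m f -> in_Sv s -> restr m f (s @: corner m) = permw s f.
Proof.
move=> Lf hs; rewrite /restr; case: pickP => [t /andP[ht /eqP e]|]; last first.
  by move/(_ s); rewrite hs eqxx.
have h : in_Sv (s * t^-1)%g.
  apply/forallP => j; rewrite permM.
  have /forallP/(_ (t^-1%g (s j))) := ht; rewrite permKV => /eqP <-.
  by have /forallP/(_ j) := hs.
have ef : permw (s * t^-1)%g f = f.
  apply: Lf => //; apply/setP => j; apply/imsetP/idP => [[i hi ->]|hj].
    have : s i \in t @: corner m by rewrite e imset_f.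
    by case/imsetP => x hx ex; rewrite permM ex permK.
  have : t j \in s @: corner m by rewrite -e imset_f.
  by case/imsetP => x hx ex; exists x => //; rewrite permM -ex permK.
have -> : permw t f = permw t (permw (s * t^-1)%g f) by rewrite ef.
rewrite /permw psubst_comp; congr (psubst _ f); apply/funext => j.
by rewrite psubst_var permM permKV.
Qed.

(* The w_{i,r} - w_{i,s} + n hbar, for r <> s. *)
Definition diffs : set wpoly := [set p | exists (j j' : J) (n : int),
  [/\ tag j = tag j', j != j' & p = w j - w j' + cst (hbar *~ n)]].
Definition diff_multset : central_multset wpoly := com_multset diffs.

Local Notation wloc := (loc diff_multset).

Definition shift (a : {ffun J -> nat}) : wpoly -> wpoly :=
  psubst (fun j => w j + cst (hbar *+ a j)).
HB.instance Definition _ a := GRing.RMorphism.on (shift a).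

Lemma shift_diffs a s : cms_set diff_multset s -> cms_set diff_multset (shift a s).
Proof.
elim=> [|x [j [j' [n [ej nj ->]]]]|x y _ hx _ hy].
- by rewrite rmorph1; exact: mult_gen1.
- apply: mult_gen_in; exists j, j', (n + (a j)%:Z - (a j')%:Z); split => //.
  rewrite rmorphD rmorphB /= /shift !psubst_var psubst_const.
  have -> : hbar *~ (n + (a j)%:Z - (a j')%:Z) = hbar *~ n + (hbar *+ a j - hbar *+ a j').
    by rewrite -addrA mulrzDr mulrzBr !pmulrn.
  by rewrite rmorphD rmorphB /= opprD addrACA -[LHS]addrA; congr (_ + _); rewrite addrC.
by rewrite rmorphM; exact: (@cmsM _ diff_multset _ _ hx hy).
Qed.

Definition wshift (a : {ffun J -> nat}) : {rmorphism wloc -> wloc} :=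
  loc_map (f := shift a) (@shift_diffs a).

Lemma wshiftE a p (s : diff_multset) :
  wshift a (frac p s) = frac (shift a p) (map_den (@shift_diffs a) s).
Proof. exact: loc_mapE. Qed.

Lemma wshift0 x : wshift 0 x = x.
Proof.
have [p [s ->]] := frac_surj x.
have e q : shift 0 q = q.
  elim/pring_ind: q => [c|j|q q' h h'|q q' h h']; rewrite /shift.
  - by rewrite psubst_const.
  - by rewrite psubst_var ffunE mulr0n rmorph0 addr0.
  - by rewrite rmorphD /= -/(shift _) h h'.
  by rewrite rmorphM /= -/(shift _) h h'.
by rewrite wshiftE e; congr (frac p _); apply: val_inj; exact: e.
Qed.

Lemma wshiftD a b x : wshift (a + b) x = wshift a (wshift b x).
Proof.
have [p [s ->]] := frac_surj x.
have e q : shift (a + b) q = shift a (shift b q).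
  rewrite /shift psubst_comp; congr (psubst _ q); apply/funext => j.
  rewrite rmorphD /= psubst_var psubst_const ffunE mulrnDr rmorphD.
  by rewrite -addrA.
by rewrite !wshiftE e; congr (frac _ _); apply: val_inj; exact: e.
Qed.

Definition shift_action : mon_action {ffun J -> nat} wloc :=
  MonAction wshift0 wshiftD.

(* The Ore localization of the algebra of difference operators; the normal
   form puts the w's on the left of the u's. *)
Definition diffop := skew shift_action.
HB.instance Definition _ := GRing.PzRing.on diffop.

Definition of_wpoly (p : wpoly) : diffop := << to_loc diff_multset p *g 0 >>.
Definition of_base (c : R) : diffop := of_wpoly (cst c).

Definition uop (j : J) : diffop := << 1 *g [ffun j' => (j' == j) : nat] >>.

Lemma uw_comm i j :
  uop i * of_wpoly (w j) = of_wpoly (w j + cst (hbar *+ (i == j))) * uop i.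
Proof.
rewrite /uop /of_wpoly !skewMUU mul1r addr0 add0r rmorph1 mulr1.
rewrite /= /to_loc wshiftE /shift psubst_var ffunE eq_sym.
by congr << frac _ _ *g _ >>; apply: val_inj; exact: rmorph1.
Qed.

Lemma of_base_central c x : of_base c * x = x * of_base c.
Proof.
apply: skew_central => [y|a]; first exact: mulrC.
rewrite /= /to_loc wshiftE /shift psubst_const.
by congr (frac _ _); apply: val_inj; exact: rmorph1.
Qed.

Definition numer (G : {set J}) : wpoly :=
  \prod_(e : E) \prod_(a in G | tag a == src e)
    \prod_(b in ~: G | tag b == tgt e)
      (w b - w a + cst (theta e - half_hbar)).

Definition denom (G : {set J}) : wpoly :=
  \prod_(a in G) \prod_(b in ~: G | tag b == tag a) (w a - w b).

Lemma denom_diffs G : cms_set diff_multset (denom G).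
Proof.
apply: big_ind => [||a aG]; [exact: mult_gen1|exact: mult_genM|].
apply: big_ind => [||b /andP[bG /eqP e]]; [exact: mult_gen1|exact: mult_genM|].
apply: mult_gen_in; exists a, b, 0; split=> //.
  by apply: contraTneq bG => <-; rewrite inE aG.
by rewrite mulr0z rmorph0 addr0.
Qed.

Definition monopole (m : I -> nat) (f : wpoly) : diffop :=
  \sum_(G : {set J} | has_size m G)
    << frac (restr m f G * numer G) (SigSub (mem_set (denom_diffs G)))
       *g [ffun j => (j \in G) : nat] >>.

Lemma monopole0 f : Lambda1 (fun=> 0%N) f -> monopole (fun=> 0%N) f = of_wpoly f.
Proof.
move=> Lf; rewrite /monopole (big_pred1 (finset.set0 : {set J})) => [|G]; last first.
  apply/forallP/eqP => [h|-> i].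
    apply/setP => j; rewrite inE; apply/negP => jG.
    have := h (tag j); rewrite cards_eq0 => /eqP/setP/(_ j).
    by rewrite !inE jG eqxx.
  by rewrite cards_eq0; apply/eqP/setP => j; rewrite !inE.
have c0 : corner (fun=> 0%N) = finset.set0 by apply/setP => j; rewrite !inE ltn0.
have f0 : restr (fun=> 0%N) f finset.set0 = f.
  have e : (1%g : {perm J}) @: corner (fun=> 0%N) = finset.set0 by rewrite c0 imset0.
  have h1 : in_Sv 1 by apply/forallP => j; rewrite perm1.
  by rewrite -e restrE //; apply: Lf; rewrite // e c0.
have n0 : numer finset.set0 = 1.
  by rewrite /numer big1 // => e _; rewrite big_pred0 // => j; rewrite inE.
have d0 : SigSub (mem_set (denom_diffs finset.set0)) = den1 diff_multset.
  by apply: val_inj; rewrite /= /denom big_pred0 // => j; rewrite inE.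
rewrite f0 n0 mulr1 d0 /of_wpoly; congr (mkmalgU _ _).
by apply/ffunP => j; rewrite !ffunE inE.
Qed.

Definition zastava : set diffop :=
  subring_gen [set x | exists m f,
    [/\ forall i, (m i <= v i)%N, Lambda1 m f & x = monopole m f]].

(* The sum over the r's of the exponents of the u_{i,r} is d_i. *)
Definition homogeneous (d : I -> nat) (x : diffop) : Prop :=
  forall a, mcoeff a x != 0 -> forall i, \sum_(j : J | tag j == i) a j = d i.

Definition zastava_deg (d : I -> nat) : set diffop :=
  zastava `&` homogeneous d.

(* Here 'X stands for z^-1. *)
Definition elemQ (i : I) (r : nat) : diffop :=
  of_wpoly (\prod_(s < v i) (1 - (w (Tagged _ s))%:P * 'X))`_r.

(* w_{i,1} is the variable of index (i, 0), which exists iff v_i > 0. *)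
Definition elemF (i : I) (r : nat) : diffop :=
  if insub 0%N is Some s
  then monopole (alpha i) (w (Tagged (fun i => 'I_(v i)) (s : 'I_(v i))) ^+ r.-1)
  else 0.

Definition elemsQF : set diffop :=
  [set x | exists i r, (0 < r)%N /\ (x = elemQ i r \/ x = elemF i r)].

Lemma Mset1 : (of_base @` Mset) 1.
Proof. by exists 1; [exact: mult_gen1|rewrite /of_base rmorph1]. Qed.
Lemma MsetM x y :
  (of_base @` Mset) x -> (of_base @` Mset) y -> (of_base @` Mset) (x * y).
Proof.
move=> [c hc <-] [d hd <-]; exists (c * d); first exact: mult_genM.
by rewrite /of_base /of_wpoly [RHS]skewMUU mon_act0 add0r !rmorphM.
Qed.
Lemma Mset_central x y : (of_base @` Mset) x -> x * y = y * x.
Proof. by move=> [c _ <-]; exact: of_base_central. Qed.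
Definition M_multset : central_multset diffop :=
  CentralMultset Mset1 MsetM Mset_central.

Definition zastava_M : set (loc M_multset) := loc_set M_multset zastava.
Definition zastava_M_deg (d : I -> nat) : set (loc M_multset) :=
  loc_set M_multset (zastava_deg d).
Definition base_M : set (loc M_multset) := loc_set M_multset (range of_base).

End Zastava.
End Quiver.

Arguments Mset {k Q}.
Arguments Lambda1 {k Q v} m f.
Arguments of_base {k Q} v c.
Arguments monopole {k Q v} m f.
Arguments zastava k {Q} v.
Arguments zastava_deg k {Q} v d.
Arguments elemsQF k {Q} v.
Arguments M_multset k {Q} v.
Arguments zastava_M k {Q} v.
Arguments zastava_M_deg k {Q} v d.
Arguments base_M k {Q} v.
Arguments spherical_subalgebra {Q B} comp.
Arguments spherically_generated {Q B} A comp.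

(* Main.v *)
(* A product of the operators F_i^(r) is a shuffle product: the summand in which
   the u-variables are w_{t_1}, ..., w_{t_d} in this order carries, besides the
   factor of the monopole operator, the product over c < a and over the arrows h
   from t_c to t_a in the doubled quiver of (w_{t_a} - w_{t_c} + theta_h - hbar/2).
   Hence, for every ordering of the points of the corner of size m, the symmetrization
   of any multiple of the corresponding product comes from the spherical subalgebra.
   The ideal generated by these products, over all orderings, meets M: if one edge
   leaving each point of a finite set is selected, the edges contain a cycle, and the
   linear forms of a cycle p add up to y_p.
   Finally, since Q is contained in k, an element of Lambda^(1^m)(v) is a polynomial in
   the corner variables and in the power sums of all the w_{i,r}; the latter come
   from the Q_i^(r) by Newton's identities. *)

Require Import Defs.
From HB Require Import structures.
From mathcomp Require Import all_boot all_order all_algebra.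
From mathcomp Require Import perm.
From mathcomp Require Import boolp classical_sets.
From mathcomp Require Import mpoly monalg.
From mathcomp Require Import ring.

Set Implicit Arguments.
Unset Strict Implicit.
Unset Printing Implicit Defensive.

Import GRing.Theory.
Local Open Scope classical_set_scope.
Local Open Scope ring_scope.

(** * Ideals meeting a multiplicative set *)

Inductive ideal_gen (S : comPzRingType) (X : set S) : set S :=
| ideal_gen0 : ideal_gen X 0
| ideal_gen_in x : X x -> ideal_gen X x
| ideal_genD x y : ideal_gen X x -> ideal_gen X y -> ideal_gen X (x + y)
| ideal_genM a x : ideal_gen X x -> ideal_gen X (a * x).

Section IdealProducts.
Variables (S : comPzRingType) (M : set S).
Hypotheses (M1 : M 1) (MM : forall x y, M x -> M y -> M (x * y)).
Implicit Types (X Y : set S) (x y a b : S).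

Lemma ideal_gen_sub X Y x : X `<=` ideal_gen Y -> ideal_gen X x -> ideal_gen Y x.
Proof.
move=> XY; elim=> [|y /XY//|y z _ hy _ hz|a y _ hy].
- exact: ideal_gen0.
- exact: ideal_genD.
- exact: ideal_genM.
Qed.

Lemma ideal_gen_mono X Y x : X `<=` Y -> ideal_gen X x -> ideal_gen Y x.
Proof. by move=> XY; apply: ideal_gen_sub => y /XY; exact: ideal_gen_in. Qed.

Lemma ideal_gen_adjoin a X x : ideal_gen (a |` X) x ->
  exists r z, ideal_gen X z /\ x = r * a + z.
Proof.
elim=> [|y [->|Xy]|y z _ [r [u [Xu ->]]] _ [s [w [Xw ->]]]|b y _ [r [u [Xu ->]]]].
- by exists 0, 0; split; [exact: ideal_gen0|rewrite mul0r addr0].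
- by exists 1, 0; split; [exact: ideal_gen0|rewrite mul1r addr0].
- by exists 0, y; split; [exact: ideal_gen_in|rewrite mul0r add0r].
- by exists (r + s), (u + w); split; [exact: ideal_genD|rewrite mulrDl addrACA].
- by exists (b * r), (b * u); split; [exact: ideal_genM|rewrite mulrDr mulrA].
Qed.

(** In $(ra+z)(sb+w)$ every term other than $rs\,ab$ has a factor $z$ or $w$ from the ideal of
    [X]. *)
Lemma ideal_gen_adjoinM a b X x y :
  ideal_gen (a |` X) x -> ideal_gen (b |` X) y -> ideal_gen (a * b |` X) (x * y).
Proof.
move=> /ideal_gen_adjoin[r [z [Xz ->]]] /ideal_gen_adjoin[s [w [Xw ->]]].
have sub : X `<=` (a * b |` X) by move=> u; right.
rewrite mulrDl; apply: ideal_genD; last first.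
  by rewrite [z * _]mulrC; apply: ideal_genM; exact: ideal_gen_mono sub Xz.
rewrite mulrDr; apply: ideal_genD; last first.
  by apply: ideal_genM; exact: ideal_gen_mono sub Xw.
by rewrite mulrACA; apply: ideal_genM; apply: ideal_gen_in; left.
Qed.

Definition meets X := exists2 h, M h & ideal_gen X h.

Lemma meets_sub X Y : X `<=` ideal_gen Y -> meets X -> meets Y.
Proof. by move=> XY [h Mh Xh]; exists h => //; exact: ideal_gen_sub XY Xh. Qed.

Lemma meets_prod (E : eqType) (l : seq E) (K : E -> S) X :
  (forall e, e \in l -> meets (K e |` X)) -> meets (\prod_(e <- l) K e |` X).
Proof.
elim: l => [|e l IH] h.
  by exists 1 => //; apply: ideal_gen_in; left; rewrite big_nil.
have [u Mu hu] := h _ (mem_head _ _).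
have [|w Mw hw] := IH; first by move=> e' e'l; apply: h; rewrite inE e'l orbT.
by exists (u * w); [exact: MM|rewrite big_cons; exact: ideal_gen_adjoinM].
Qed.

(* If (X, a) and (X, b) contain x and y, then (X, ab) contains xy; so it is enough to
   treat each choice of one factor from every product. *)
Lemma meets_choice (V E : eqType) (e0 : E) (s : seq V) (out : V -> seq E)
    (K : E -> S) X :
  uniq s ->
  (forall f : V -> E, {in s, forall t, f t \in out t} ->
     meets (X `|` [set K (f t) | t in [set` s]])) ->
  meets (X `|` [set \prod_(e <- out t) K e | t in [set` s]]).
Proof.
elim: s X => [|t s IH] X /=.
  (* With no products left there is nothing to choose; [e0] merely provides some function into
     [E]. *)
  move=> _ /(_ (fun=> e0)) []// h Mh Xh; exists h => //.
  by apply: (ideal_gen_mono _ Xh) => x [|[u /=]]//; left.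
move=> /andP[ts us] h.
pose Y := X `|` [set \prod_(e <- out u) K e | u in [set` s]].
have: meets (\prod_(e <- out t) K e |` Y).
  (* The factor [K e] picked for [t] joins [X], so the induction hypothesis is applied to the
     enlarged set. *)
  apply: meets_prod => e et; rewrite /Y setUA; apply: IH => // f hf.
  have [u|u Mu hu] := h (fun u => if u == t then e else f u).
    by rewrite inE; case: eqP => [->|_] //= /hf.
  exists u => //; apply: (ideal_gen_mono _ hu) => x [Xx|[w /=]]; first by left; right.
  rewrite inE; case: eqP => [_ _ <-|_ /= ws <-]; first by left; left.
  by right; exists w.
apply: meets_sub => x hx; apply: ideal_gen_in.
case: hx => [->|[Xx|[u us' <-]]].
- by right; exists t; rewrite //= mem_head.
- by left.
- by right; exists u; rewrite //= inE us' orbT.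
Qed.

End IdealProducts.

(** * Orderings of the points and closed paths *)

(** The iterates of [x0] must repeat; the first repeated one, which need not be [x0], is
    periodic. *)
Lemma functional_cycle (V : finType) (a : V -> V) (A : {set V}) (x0 : V) :
  x0 \in A -> {in A, forall x, a x \in A} ->
  exists t n, [/\ t \in A, (0 < n)%N & iter n a t = t].
Proof.
move=> x0A aA; have := looping_order a x0; rewrite /looping.
case/trajectP=> i lt_i e; exists (iter i a x0), (fingraph.order a x0 - i)%N; split.
- by elim: i {lt_i e} => //= i; exact: aA.
- by rewrite subn_gt0.
by rewrite -iterD subnK // ltnW.
Qed.

Section Orderings.
Variables (k : comNzRingType) (Q : quiver) (V : finType) (col : V -> vertex Q).
Variables (S : comNzRingType) (c : {rmorphism base_ring k Q -> S}) (x : V -> S).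
Local Notation E := (arrow Q).
Local Notation half_hbar := (half_hbar k Q).
Implicit Types (t a : V) (A : {set V}) (ts : seq V) (h : E + E).

(* Up to sign, x_a - x_t + theta_h - hbar/2 for the arrow h of the doubled
   quiver; the sign is the one with which it occurs in a monopole product. *)
Definition ell t a h : S :=
  match h with
  | inl e => x a - x t + c (theta k e - half_hbar)
  | inr e => x t - x a + c (theta k e + half_hbar)
  end.

Definition arrs t a h := (dsrc h == col t) && (dtgt h == col a).

Definition link t A : S := \prod_(a in A) \prod_(h | arrs t a h) ell t a h.

Fixpoint ordprod ts : S :=
  if ts is t :: ts' then link t [set a in ts']%SET * ordprod ts' else 1.

Definition orderings A : set (seq V) := [set ts | uniq ts /\ [set a in ts]%SET = A].

Section Choice.
Variables (A : {set V}) (J : set S) (nx : V -> V) (ar : V -> E + E).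
Hypothesis nxA : {in A, forall t, nx t \in A}.
Hypothesis arA : {in A, forall t, arrs t (nx t) (ar t)}.
Hypothesis ellJ : {in A, forall t, J (ell t (nx t) (ar t))}.

Lemma choice_path t n : t \in A ->
  path (fun h h' => dtgt h == dsrc h') (ar t) (map ar (traject nx (nx t) n)).
Proof.
elim: n t => //= n IH t tA; rewrite IH ?nxA // andbT.
have /andP[_ /eqP ->] := arA tA.
by have /andP[/eqP -> _] := arA (nxA tA).
Qed.

(** Up to sign, each selected form is $\theta_h-\hbar/2$ plus a difference of two values of [x], and
    these differences telescope along the path. *)
Lemma choice_sum t n : t \in A ->
  ideal_gen J (c (y_path k (map ar (traject nx t n))) + (x (iter n nx t) - x t)).
Proof.
elim: n t => [|n IH] t tA.
  by rewrite /= subrr addr0 /y_path big_nil mulr0n subr0 rmorph0; exact: ideal_gen0.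
have e : c (dtheta k (ar t)) - c half_hbar + (x (nx t) - x t)
    = (if ar t is inl _ then 1 else -1) * ell t (nx t) (ar t).
  rewrite /ell; case: (ar t) => e /=.
    by rewrite mul1r rmorphB addrC.
  by rewrite mulN1r rmorphN rmorphD !opprD !opprK addrC [x (nx t) - _]addrC.
rewrite iterSr /= /y_path big_cons /= mulrS opprD addrACA rmorphD rmorphB.
have -> : x (iter n nx (nx t)) - x t
    = (x (nx t) - x t) + (x (iter n nx (nx t)) - x (nx t)) by rewrite [RHS]addrC addrA subrK.
rewrite addrACA e; apply: ideal_genD; last exact: IH (nxA tA).
by apply: ideal_genM; apply: ideal_gen_in; exact: ellJ.
Qed.

(** Following [nx] from [t0] ends in a cycle; there the telescoping difference vanishes, and
    [y_path] of a closed path remains. *)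
Lemma choice_cycle t0 : t0 \in A -> meets (c @` Mset) J.
Proof.
move=> t0A; have [t [[|n] [tA // _ e]]] := functional_cycle t0A nxA.
exists (c (y_path k (map ar (traject nx t n.+1)))).
  exists (y_path k (map ar (traject nx t n.+1))) => //.
  apply: mult_gen_in; exists (map ar (traject nx t n.+1)) => //.
  (* [cycle] appends the first arrow again; since the trajectory has returned to [t], this is the
     arrow path one step longer. *)
  rewrite /closed_path /= -map_rcons -[X in rcons _ X]e iterSr -trajectSr.
  exact: choice_path.
by have := choice_sum n.+1 tA; rewrite e subrr addr0.
Qed.

End Choice.

Lemma Mset_img1 : (c @` Mset) 1.
Proof. by exists 1; [exact: mult_gen1|rewrite rmorph1]. Qed.
Lemma Mset_imgM y z : (c @` Mset) y -> (c @` Mset) z -> (c @` Mset) (y * z).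
Proof.
by move=> [h Mh <-] [g Mg <-]; exists (h * g); [exact: mult_genM|rewrite rmorphM].
Qed.

(** Each [link] is a product over the edges leaving [t], so [meets_choice] reduces the claim to one
    selected edge per point, which is [choice_cycle]. *)
Lemma link_meets A t0 : t0 \in A ->
  meets (c @` Mset) [set link t (A :\ t)%SET | t in [set` A]].
Proof.
move=> t0A.
pose out t : seq (V * (V * (E + E))) :=
  [seq (t, p) | p <- enum [pred p : V * (E + E) | (p.1 \in A :\ t)%SET && arrs t p.1 p.2]].
pose K (e : V * (V * (E + E))) := ell e.1 e.2.1 e.2.2.
have linkE t : link t (A :\ t)%SET = \prod_(e <- out t) K e.
  by rewrite /link pair_big_dep /= /out big_map big_enum.
(* If no edge leaves [t0], its link is the empty product 1; otherwise [out t0] supplies the default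
   edge for [meets_choice]. *)
case: (eqVneq (out t0) [::]) => [out0|].
  exists 1; first exact: Mset_img1.
  by apply: ideal_gen_in; exists t0; rewrite //= linkE out0 big_nil.
case out0: (out t0) => [//|e0 l0] _ {l0 out0}.
have := @meets_choice S _ Mset_img1 Mset_imgM _ _ e0 (enum A) out K set0 (enum_uniq A).
have -> : [set \prod_(e <- out t) K e | t in [set` enum A]]
    = [set link t (A :\ t)%SET | t in [set` A]].
  by apply/seteqP; split=> _ [t tA <-]; exists t; rewrite ?linkE //= mem_enum in tA *.
rewrite !set0U; apply=> f hf.
have hf' t : t \in A -> [/\ (f t).1 = t, (f t).2.1 \in A & arrs t (f t).2.1 (f t).2.2].
  move=> tA; have /mapP[[a h]] := hf t (etrans (mem_enum _ _) tA).
  by rewrite mem_enum inE /= !inE => /andP[/andP[_ aA] r] ->.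
rewrite set0U.
apply: (@choice_cycle A _ (fun t => (f t).2.1) (fun t => (f t).2.2)) t0A => t tA.
- by have [] := hf' t tA.
- by have [] := hf' t tA.
exists t; first by rewrite /= mem_enum.
by rewrite /K; have [-> _ _] := hf' t tA.
Qed.

(** Induction on the size of [A]: putting [t] in front of an ordering of the other points multiplies
    its [ordprod] by the link of [t] with them. *)
Lemma ordprod_meets A : meets (c @` Mset) (ordprod @` orderings A).
Proof.
have [n] := ubnP #|A|; elim: n A => // n IH A; rewrite ltnS => leAn.
have [->|[t0 t0A]] := set_0Vmem A.
  exists 1; first exact: Mset_img1.
  apply: ideal_gen_in; exists [::] => //; split => //; apply/setP => t; rewrite !inE.
have /boolp.choice[H HP] t : exists h : S, t \in A ->
    (c @` Mset) h /\ ideal_gen (ordprod @` orderings (A :\ t)%SET) h.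
  case tA: (t \in A); last by exists 1.
  have [|h] := IH (A :\ t)%SET; last by exists h.
  by move: leAn; rewrite (cardsD1 t) tA.
have [g Mg hg] := link_meets t0A.
(* Each link occurring in [g] needs its own multiplier [H t]; the product serves all of them at
   once. *)
exists ((\prod_(t in A) H t) * g).
  apply: Mset_imgM => //; apply: big_ind => [||t tA]; first exact: Mset_img1.
    exact: Mset_imgM.
  by have [] := HP t tA.
elim: {g Mg} hg => [|_ [t tA <-]|y z _ hy _ hz|b y _ hy].
- by rewrite mulr0; exact: ideal_gen0.
- rewrite (bigD1 t) //= mulrAC; set r := \prod_(_ in _ | _) _.
  rewrite mulrC; apply: ideal_genM.
  have [_ {r}] := HP t tA; elim=> [|_ [ts [us es] <-]|y z _ hy _ hz|b y _ hy].
  + by rewrite mul0r; exact: ideal_gen0.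
  + apply: ideal_gen_in; exists (t :: ts); last by rewrite /= es mulrC.
    split.
      by rewrite /= us andbT; move/setP/(_ t): es; rewrite !inE eqxx => ->.
    apply/setP => u; move/setP/(_ u): es; rewrite !inE => ->.
    by case: eqP => [->|] //; rewrite tA.
  + by rewrite mulrDl; exact: ideal_genD.
  + by rewrite -mulrA; exact: ideal_genM.
- by rewrite mulrDr; exact: ideal_genD.
by rewrite mulrCA; exact: ideal_genM.
Qed.

End Orderings.

(** * Compatibility of the ordered products with ring morphisms and injections of points *)

Section OrderingsMorphism.
Variables (k : comNzRingType) (Q : quiver) (V V' : finType).
Variables (col : V -> vertex Q) (col' : V' -> vertex Q) (S S' : comNzRingType).
Variables (c : {rmorphism base_ring k Q -> S}) (c' : {rmorphism base_ring k Q -> S'}).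
Variables (x : V -> S) (x' : V' -> S') (g : {rmorphism S -> S'}) (e : V -> V').
Hypotheses (e_inj : injective e) (col_e : forall t, col' (e t) = col t).
Hypotheses (gc : forall r, g (c r) = c' r) (gx : forall t, g (x t) = x' (e t)).

Lemma link_morph t (A : {set V}) :
  g (link col c x t A) = link col' c' x' (e t) (e @: A).
Proof.
rewrite /link big_imset /=; last by move=> ? ? _ _; exact: e_inj.
rewrite rmorph_prod; apply: eq_bigr => a _; rewrite rmorph_prod.
apply: eq_big => [h|h _]; first by rewrite /arrs !col_e.
by case: h => h /=; rewrite rmorphD rmorphB /= !gx gc.
Qed.

Lemma imset_map_set (ts : seq V) : [set a in map e ts]%SET = e @: [set a in ts].
Proof.
apply/setP => a; rewrite inE.
by apply/mapP/imsetP => -[t tA ->]; exists t; rewrite ?inE // in tA *.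
Qed.

Lemma ordprod_morph (ts : seq V) :
  g (ordprod col c x ts) = ordprod col' c' x' (map e ts).
Proof.
elim: ts => [|t ts IH] /=; first by rewrite rmorph1.
by rewrite rmorphM IH link_morph -imset_map_set.
Qed.

End OrderingsMorphism.

(** * Subrings of polynomials *)

Section SubringGen.
Variable A : pzRingType.
Implicit Types (X Y : set A) (x y : A).

Lemma subring_gen0 X : subring_gen X 0.
Proof. by rewrite -(subrr 1); apply: subring_genB; exact: subring_gen1. Qed.

Lemma subring_genN X x : subring_gen X x -> subring_gen X (- x).
Proof. by move=> Xx; rewrite -sub0r; apply: subring_genB Xx; exact: subring_gen0. Qed.

Lemma subring_genD X x y :
  subring_gen X x -> subring_gen X y -> subring_gen X (x + y).
Proof. by move=> Xx Xy; rewrite -[y]opprK; exact/(subring_genB Xx)/subring_genN. Qed.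

Lemma subring_gen_sum X (T : Type) (r : seq T) (P : pred T) (F : T -> A) :
  (forall i, P i -> subring_gen X (F i)) -> subring_gen X (\sum_(i <- r | P i) F i).
Proof.
move=> h; apply: big_ind => //; [exact: subring_gen0|exact: subring_genD].
Qed.

Lemma subring_gen_prod X (T : Type) (r : seq T) (P : pred T) (F : T -> A) :
  (forall i, P i -> subring_gen X (F i)) -> subring_gen X (\prod_(i <- r | P i) F i).
Proof.
move=> h; apply: big_ind => //; [exact: subring_gen1|exact: subring_genM].
Qed.

Lemma subring_genX X x n : subring_gen X x -> subring_gen X (x ^+ n).
Proof.
by move=> Xx; elim: n => [|n IH]; [exact: subring_gen1|rewrite exprS; exact: subring_genM].
Qed.

Lemma subring_genMn X x n : subring_gen X x -> subring_gen X (x *+ n).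
Proof.
by move=> Xx; rewrite -[n]card_ord -sumr_const; apply: subring_gen_sum.
Qed.

Lemma subring_gen_sub X Y x :
  X `<=` subring_gen Y -> subring_gen X x -> subring_gen Y x.
Proof.
move=> XY; elim=> [|y /XY//|y z _ hy _ hz|y z _ hy _ hz]; first exact: subring_gen1.
- exact: subring_genB.
- exact: subring_genM.
Qed.

End SubringGen.

Section PolynomialsInVariables.
Variables (R : comNzRingType) (T : finType).
Implicit Types (A B : {set T}) (t : T) (p : pring R T).

Definition polys_in A : set (pring R T) :=
  subring_gen (range (@pconst R T) `|` [set pvar R t | t in [set` A]]).

Lemma polys_in_const A c : polys_in A (pconst T c).
Proof. by apply: subring_gen_in; left; exists c. Qed.

Lemma polys_in_var A t : t \in A -> polys_in A (pvar R t).
Proof. by move=> tA; apply: subring_gen_in; right; exists t. Qed.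

Lemma polys_in_sub A B p : A \subset B -> polys_in A p -> polys_in B p.
Proof.
move=> /fintype.subsetP AB; apply: subring_gen_sub => _ [[c _ <-]|[t tA <-]].
  exact: polys_in_const.
by apply: polys_in_var; exact: AB.
Qed.

Lemma polys_in_psubst A p (F : T -> pring R T) :
  {in A, forall t, F t = pvar R t} -> polys_in A p -> psubst F p = p.
Proof.
move=> FA; elim=> [|_ [[c _ <-]|[t tA <-]]|q r _ hq _ hr|q r _ hq _ hr].
- by rewrite rmorph1.
- by rewrite psubst_const.
- by rewrite psubst_var FA.
- by rewrite rmorphB /= hq hr.
- by rewrite rmorphM /= hq hr.
Qed.

(** Separates a new variable from the old ones: its powers will be supplied by an orbit sum over one
    point, the coefficients by one over [A]. *)
Lemma polys_in_horner A t p : polys_in (t |: A)%SET p ->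
  exists2 H : {poly pring R T}, (forall n, polys_in A H`_n) & p = H.[pvar R t].
Proof.
elim=> [|q [[c _ <-]|[u]]|q r _ [H hH ->] _ [G hG ->]|q r _ [H hH ->] _ [G hG ->]].
- exists 1; rewrite ?hornerC // => n; rewrite coef1.
  by case: eqP => _; [exact: subring_gen1|exact: subring_gen0].
- exists (pconst T c)%:P; rewrite ?hornerC // => n; rewrite coefC.
  by case: eqP => _; [exact: polys_in_const|exact: subring_gen0].
- rewrite /= !inE => /orP[/eqP ->|uA] <-.
    exists 'X; rewrite ?hornerX // => n; rewrite coefX.
    by case: eqP => _; [exact: subring_gen1|exact: subring_gen0].
  exists (pvar R u)%:P; rewrite ?hornerC // => n; rewrite coefC.
  by case: eqP => _; [exact: polys_in_var|exact: subring_gen0].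
- exists (H - G); rewrite ?hornerE // => n; rewrite coefB.
  by apply: subring_genB; [exact: hH|exact: hG].
- exists (H * G); rewrite ?hornerM // => n; rewrite coefM.
  by apply: subring_gen_sum => i _; apply: subring_genM; [exact: hH|exact: hG].
Qed.

End PolynomialsInVariables.

(** * Permutations, shifts and collision factors *)

Section Permutations.
Variables (k : comNzRingType) (Q : quiver) (v : vertex Q -> nat).
Local Notation J := (windex v).
Local Notation R := (base_ring k Q).
Local Notation wpoly := (pring R J).
Local Notation w := (@pvar R J).
Implicit Types (s : {perm J}) (A : {set J}) (t a : J) (p : wpoly).

HB.instance Definition _ s := GRing.RMorphism.on (@permw k Q v s).

Lemma permw_var s t : permw s (w t) = w (s t).
Proof. exact: psubst_var. Qed.

Lemma permw_const s (c : R) : permw s (pconst J c) = pconst J c.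
Proof. exact: psubst_const. Qed.

Lemma permwM (s1 s2 : {perm J}) p : permw (s1 * s2)%g p = permw s2 (permw s1 p).
Proof.
rewrite /permw psubst_comp; congr (psubst _ p); apply/funext => t.
by rewrite psubst_var permM.
Qed.

Lemma tag_in_Sv s t : in_Sv s -> tag (s t) = tag t.
Proof. by move=> /forallP/(_ t)/eqP. Qed.

Lemma in_Sv1 : in_Sv (1%g : {perm J}).
Proof. by apply/forallP => t; rewrite perm1. Qed.

Lemma in_SvM (s1 s2 : {perm J}) : in_Sv s1 -> in_Sv (s2 * s1)%g = in_Sv s2.
Proof.
move=> h1; apply/forallP/forallP => h t; have := h t.
  by rewrite permM (tag_in_Sv _ h1).
by rewrite permM (tag_in_Sv _ h1).
Qed.

Lemma in_SvMl (s1 s2 : {perm J}) : in_Sv s1 -> in_Sv (s1 * s2)%g = in_Sv s2.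
Proof.
move=> h1; apply/forallP/forallP => h t.
  have := h (s1^-1%g t); rewrite permM permKV => /eqP ->.
  by rewrite -(tag_in_Sv _ h1) permKV.
by rewrite permM (eqP (h _)) tag_in_Sv.
Qed.

Lemma in_Sv_tperm t t' : tag t = tag t' -> in_Sv (tperm t t').
Proof.
move=> e; apply/forallP => a; case: tpermP => [->|->|_ _]; rewrite ?e ?eqxx //.
Qed.

Lemma tperm_fix A t t' : t \notin A -> t' \notin A -> {in A, tperm t t' =1 id}.
Proof.
by move=> tA t'A a aA; rewrite tpermD //; [apply: contraNneq tA|apply: contraNneq t'A] => ->.
Qed.

Lemma imset_fix s A : {in A, s =1 id} -> s @: A = A.
Proof. by move=> h; rewrite (eq_in_imset h) imset_id. Qed.

(** The exponent of $\prod_{t\in A}u_t$. *)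
Definition indic A : {ffun J -> nat} := [ffun j => (j \in A) : nat].

Lemma shift_permw s A p :
  shift (indic (s @: A)) (permw s p) = permw s (shift (indic A) p).
Proof.
rewrite /permw /shift [LHS]psubst_comp [RHS]psubst_comp.
apply: (congr1 (fun F => psubst F p)); apply/funext => t.
rewrite psubst_var rmorphD /= psubst_var psubst_const !ffunE mem_imset //.
exact: perm_inj.
Qed.

Lemma shift_polys_in A p t : t \notin A -> polys_in A p ->
  shift (indic [set t]) p = p.
Proof.
move=> tA; apply: polys_in_psubst => a aA; rewrite ffunE inE.
by case: eqP aA tA => [->|] => [->//|]; rewrite mulr0n rmorph0 addr0.
Qed.

Lemma permw_polys_in s A p : {in A, s =1 id} -> polys_in A p -> permw s p = p.
Proof. by move=> h; apply: polys_in_psubst => t /h ->. Qed.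

Local Notation mlink := (link (@tag _ _) (@pconst R J) w).

Lemma permw_link s t A : in_Sv s -> permw s (mlink t A) = mlink (s t) (s @: A).
Proof.
move=> hs; apply: link_morph => [|u|r|u]; first exact: perm_inj.
- exact: tag_in_Sv.
- exact: permw_const.
exact: permw_var.
Qed.

(** For $t\notin A$, the extra denominator in the product of the summands of $\{t\}$ and $A$:
    $w_t-w_a$ comes from the first, and $w_a-w_t-\hbar$ from the second after $u_t$ has moved past
    it. *)
Definition collision t A : wpoly :=
  \prod_(a in A)
    (if tag a == tag t then (w t - w a) * (w a - (w t + pconst J (hbar k Q))) else 1).

Lemma permw_collision s t A :
  in_Sv s -> permw s (collision t A) = collision (s t) (s @: A).
Proof.
move=> hs; rewrite /collision big_imset /=; last by move=> ? ? _ _; exact: perm_inj.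
rewrite rmorph_prod; apply: eq_bigr => a _; rewrite !tag_in_Sv //.
case: ifP => _; last by rewrite rmorph1.
by rewrite rmorphM !rmorphB rmorphD /= !permw_var permw_const.
Qed.

(** An indeterminate replaces [w t] in [collision], so that only variables of [A] occur in the
    coefficients. *)
Definition collision_poly (i : vertex Q) A : {poly wpoly} :=
  \prod_(a in A)
    (if tag a == i then ('X - (w a)%:P) * ((w a - pconst J (hbar k Q))%:P - 'X) else 1).

Lemma collision_polyE t A : (collision_poly (tag t) A).[w t] = collision t A.
Proof.
rewrite /collision_poly horner_prod; apply: eq_bigr => a _.
case: ifP => _; rewrite ?hornerC // !hornerE.
by congr (_ * _); rewrite opprD addrA addrAC.
Qed.

(** For $a=t$ the shift turns the root $w_t-\hbar$ of the second factor into $w_t$. *)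
Lemma collision_poly_shift t A : t \in A ->
  (map_poly (shift (indic [set t])) (collision_poly (tag t) A)).[w t] = 0.
Proof.
move=> tA; rewrite /collision_poly (bigD1 t) //= eqxx !rmorphM /= !hornerM.
rewrite [X in _ * X * _](_ : _ = 0) ?mulr0 ?mul0r //.
rewrite rmorphB /= map_polyC map_polyX /= !hornerE rmorphB /= /shift psubst_var psubst_const.
by rewrite ffunE inE eqxx mulr1n addrK subrr.
Qed.

Lemma collision_poly_polys_in i A n : polys_in A (collision_poly i A)`_n.
Proof.
rewrite /collision_poly; move: n.
have coefP (p : wpoly) n : polys_in A p -> polys_in A (p%:P)`_n.
  by rewrite coefC; case: eqP => // _ _; exact: subring_gen0.
have coef_1 n : polys_in A (1 : {poly wpoly})`_n.
  by rewrite coef1; case: eqP => _; [exact: subring_gen1|exact: subring_gen0].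
have coefX n : polys_in A ('X : {poly wpoly})`_n.
  by rewrite coefX; case: eqP => _; [exact: subring_gen1|exact: subring_gen0].
have coefM (p q : {poly wpoly}) n : (forall n, polys_in A p`_n) ->
    (forall n, polys_in A q`_n) -> polys_in A (p * q)`_n.
  move=> hp hq; rewrite coefM; apply: subring_gen_sum => j _.
  by apply: subring_genM; [exact: hp|exact: hq].
apply: (big_ind (fun p : {poly wpoly} => forall n, polys_in A p`_n)) => [n|p q hp hq n|a aA].
- exact: coef_1.
- exact: coefM.
case: ifP => _ n; last exact: coef_1.
have wa := polys_in_var R aA.
apply: coefM => {}n; rewrite coefB; apply: subring_genB.
- exact: coefX.
- exact: coefP.
- by apply: coefP; apply: subring_genB => //; exact: polys_in_const.
- exact: coefX.
Qed.

End Permutations.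

(** * Products of monopole summands *)

(** Pairs leaving $\{t\}\cup A$ are collected first; the remaining ones join $t$ to a point of $A$,
    in both directions. *)
Lemma prod_pairs_setU1 (K : comPzRingType) (J : finType) (t : J) (A : {set J})
    (F F' : J -> J -> K) : t \notin A ->
  (forall a b, a \in A -> b \notin (t |: A)%SET -> F' a b = F a b) ->
  (\prod_(a in [set t]%SET) \prod_(b in ~: [set t]%SET) F a b) *
  (\prod_(a in A) \prod_(b in ~: A) F' a b) =
  (\prod_(a in t |: A) \prod_(b in ~: (t |: A)) F a b) *
  \prod_(a in A) (F t a * F' a t).
Proof.
move=> tA FF'; rewrite big_set1 [X in _ = X * _]big_setU1 //= big_split /=.
have -> : \prod_(b in ~: [set t]) F t b =
    (\prod_(b in A) F t b) * \prod_(b in ~: (t |: A)) F t b.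
  rewrite [LHS](bigID (mem A)) /=; congr (_ * _); apply: eq_bigl => b.
    by rewrite !inE; case: eqP => [->|]; rewrite ?(negbTE tA) ?andbT.
  by rewrite !inE negb_or.
have -> : \prod_(a in A) \prod_(b in ~: A) F' a b =
    (\prod_(a in A) F' a t) * \prod_(a in A) \prod_(b in ~: (t |: A)) F a b.
  rewrite -big_split /=; apply: eq_bigr => a aA.
  rewrite (bigD1 t) ?inE //=; congr (_ * _).
  apply: eq_big => [b|b]; first by rewrite !inE negb_or andbC.
  by rewrite !inE => bA; apply: FF' => //; rewrite !inE negb_or andbC.
by rewrite mulrACA [RHS]mulrC.
Qed.

Lemma to_loc_frac (K : comPzRingType) (S : central_multset K) (x y a b : K) (s t : S) :
  val t * (x * a) = val s * (y * b) ->
  to_loc S x * Defs.frac a s = to_loc S y * Defs.frac b t.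
Proof.
move=> e; rewrite /to_loc !fracM; apply/fracP; exists (den1 S).
by rewrite /= !mul1r.
Qed.

Lemma mulr_cancel_mid (K : comPzRingType) (r x y a b : K) :
  x * a = y * b -> r * x * a = r * y * b.
Proof. by move=> e; rewrite -mulrA e mulrA. Qed.

Lemma mulr_cross (K : comPzRingType) (n N l d D y : K) :
  n = N * l -> d = D * y -> D * (y * n) = d * (l * N).
Proof. by move=> -> ->; rewrite mulrA [N * l]mulrC. Qed.

Section Monomials.
Variables (k : comNzRingType) (Q : quiver) (v : vertex Q -> nat).
Local Notation J := (windex v).
Local Notation E := (arrow Q).
Local Notation R := (base_ring k Q).
Local Notation wpoly := (pring R J).
Local Notation w := (@pvar R J).
Local Notation wloc := (loc (diff_multset k v)).
Local Notation to_wloc := (to_loc (diff_multset k v)).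
Local Notation numer := (@numer k Q v).
Local Notation denom := (@denom k Q v).
Local Notation mlink := (link (@tag _ _) (@pconst R J) w).
Implicit Types (s : {perm J}) (A : {set J}) (t a : J) (p q : wpoly).

Lemma shiftw A t : shift (indic A) (w t) = w t + pconst J (hbar k Q *+ (t \in A)).
Proof. by rewrite /shift psubst_var ffunE. Qed.

(** An arrow from [t] to [a] gives its factor unshifted; for an arrow from [a] to [t] the shift of
    $w_t$ by $\hbar$ turns $-\hbar/2$ into $+\hbar/2$, as in [ell]. *)
Lemma numer_shift t A : t \notin A ->
  numer [set t] * shift (indic [set t]) (numer A) = numer (t |: A) * mlink t A.
Proof.
move=> tA.
(* The vertex conditions move into the factor, with value 1 when they fail, so that
   [prod_pairs_setU1] applies. *)
pose F (e : E) (a b : J) := if (tag a == src e) && (tag b == tgt e)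
  then w b - w a + pconst J (theta k e - half_hbar k Q) else 1.
have numerE A' : numer A' = \prod_e \prod_(a in A') \prod_(b in ~: A') F e a b.
  apply: eq_bigr => e _; rewrite big_mkcondr; apply: eq_bigr => a _.
  rewrite big_mkcondr /F; case: eqP => _ /=; last by rewrite big1.
  by apply: eq_bigr.
rewrite !numerE rmorph_prod -big_split /=.
pose F' e a b := shift (indic [set t]) (F e a b).
under eq_bigr => e _.
  rewrite [X in _ * X](_ : _ = \prod_(a in A) \prod_(b in ~: A) F' e a b); last first.
    by rewrite rmorph_prod; apply: eq_bigr => a _; rewrite rmorph_prod.
  rewrite (@prod_pairs_setU1 _ _ t A (F e) (F' e) tA); last first.
    move=> a b aA bA; rewrite /F' /F; case: ifP => _; last by rewrite rmorph1.
    have /negbTE at' : a != t by apply: contraNneq tA => <-.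
    have /negbTE bt : b != t by apply: contraNneq bA => ->; rewrite !inE eqxx.
    rewrite rmorphD rmorphB /= !shiftw !inE at' bt !mulr0n rmorph0 !addr0.
    by rewrite /shift psubst_const.
  over.
rewrite big_split /=; congr (_ * _); rewrite exchange_big; apply: eq_bigr => a aA.
rewrite big_split /= big_sumType /= /arrs /=; congr (_ * _).
  rewrite [RHS]big_mkcond; apply: eq_bigr => e _; rewrite /F.
  by rewrite ![_ == tag _]eq_sym.
rewrite [RHS]big_mkcond; apply: eq_bigr => e _; rewrite /F' /F.
rewrite ![_ == tag _]eq_sym andbC; case: ifP => _; last by rewrite rmorph1.
have /negbTE at' : a != t by apply: contraNneq tA => <-.
rewrite rmorphD rmorphB /= !shiftw !inE at' eqxx mulr0n mulr1n rmorph0 addr0.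
rewrite /shift psubst_const [w t + _ - _]addrAC -[LHS]addrA; congr (_ + _).
rewrite -[LHS]rmorphD; congr (pconst J _).
by rewrite addrCA /hbar mulr2n addrK.
Qed.

Lemma denom_shift t A : t \notin A ->
  denom [set t] * shift (indic [set t]) (denom A) = denom (t |: A) * collision k t A.
Proof.
move=> tA.
pose F (a b : J) := if tag b == tag a then w a - w b else 1.
have denomE A' : denom A' = \prod_(a in A') \prod_(b in ~: A') F a b.
  by apply: eq_bigr => a _; rewrite big_mkcondr.
rewrite !denomE rmorph_prod.
pose F' a b := shift (indic [set t]) (F a b).
rewrite [X in _ * X](_ : _ = \prod_(a in A) \prod_(b in ~: A) F' a b); last first.
  by apply: eq_bigr => a _; rewrite rmorph_prod.
rewrite (@prod_pairs_setU1 _ _ t A F F' tA); last first.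
  move=> a b aA bA; rewrite /F' /F; case: ifP => _; last by rewrite rmorph1.
  have /negbTE at' : a != t by apply: contraNneq tA => <-.
  have /negbTE bt : b != t by apply: contraNneq bA => ->; rewrite !inE eqxx.
  by rewrite rmorphB /= !shiftw !inE at' bt !mulr0n rmorph0 !addr0.
congr (_ * _); apply: eq_bigr => a aA; rewrite /F' /F [tag t == _]eq_sym.
case: ifP => _; last by rewrite rmorph1 mulr1.
have /negbTE at' : a != t by apply: contraNneq tA => <-.
by rewrite rmorphB /= !shiftw !inE at' eqxx mulr0n mulr1n rmorph0 addr0.
Qed.

Definition den A : diff_multset k v := SigSub (mem_set (denom_diffs k A)).

Definition mono_coef A : wloc := Defs.frac (numer A) (den A).

Definition mono A p : diffop k v := monalg.mkmalgU (indic A) (to_wloc p * mono_coef A).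

Lemma monoE p A :
  mono A p = monalg.mkmalgU (indic A) (Defs.frac (p * numer A) (den A)).
Proof.
rewrite /mono /mono_coef /to_loc fracM; congr (mkmalgU _ (Defs.frac _ _)).
by apply: val_inj; rewrite /= mul1r.
Qed.

Lemma mono_is_additive A : zmod_morphism (mono A).
Proof. by move=> p q; rewrite /mono rmorphB mulrBl [LHS]monalgUB. Qed.
HB.instance Definition _ A :=
  GRing.isZmodMorphism.Build wpoly (diffop k v) (mono A) (mono_is_additive A).

Lemma wpolyM p q : of_wpoly (p * q) = of_wpoly p * of_wpoly q.
Proof. by rewrite /of_wpoly [RHS]skewMUU mon_act0 addr0 rmorphM. Qed.

Lemma mono_wpoly p q A : of_wpoly p * mono A q = mono A (p * q).
Proof. by rewrite /of_wpoly /mono [LHS]skewMUU mon_act0 add0r rmorphM mulrA. Qed.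

Definition mono_coef2 t A : wloc :=
  mono_coef [set t] * wshift k (indic [set t]) (mono_coef A).

(** The point [t] may lie in [A], and then $u_t$ has exponent 2; [orbsum_step] makes such terms
    cancel to zero. *)
Definition mono2 t A p : diffop k v :=
  monalg.mkmalgU (indic [set t] + indic A) (to_wloc p * mono_coef2 t A).

Lemma mono2_is_additive t A : zmod_morphism (mono2 t A).
Proof. by move=> p q; rewrite /mono2 rmorphB mulrBl [LHS]monalgUB. Qed.
HB.instance Definition _ t A :=
  GRing.isZmodMorphism.Build wpoly (diffop k v) (mono2 t A) (mono2_is_additive t A).

Lemma mono_mul p q t A :
  mono [set t] p * mono A q = mono2 t A (p * shift (indic [set t]) q).
Proof.
rewrite /mono [LHS]skewMUU /=; congr (mkmalgU _ _).
rewrite rmorphM /= /mono_coef2 mulrACA rmorphM; congr (_ * _ * _).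
rewrite /to_loc wshiftE; congr (Defs.frac _ _); apply: val_inj; exact: rmorph1.
Qed.

(** Cross-multiplication of [numer_shift] with [denom_shift]; the extra denominators appear as a
    multiplier and are never inverted. *)
Lemma mono_coef2E t A : t \notin A ->
  to_wloc (collision k t A) * mono_coef2 t A = to_wloc (mlink t A) * mono_coef (t |: A).
Proof.
move=> tA; set d := indic [set t].
have -> : mono_coef2 t A = Defs.frac (numer [set t] * shift d (numer A))
    (denM (den [set t]) (map_den (shift_diffs d) (den A))).
  by rewrite /mono_coef2 /mono_coef wshiftE; exact: fracM.
apply: to_loc_frac.
exact: mulr_cross (numer_shift tA) (denom_shift tA).
Qed.

Lemma mono2_collision r t A : t \notin A ->
  mono2 t A (r * collision k t A) = mono (t |: A) (r * mlink t A).
Proof.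
move=> tA; rewrite /mono2 /mono; congr (mkmalgU _ _).
  apply/ffunP => a; rewrite !ffunE !inE.
  by case: eqP => [->|_]; rewrite ?(negbTE tA).
rewrite [to_wloc (r * collision _ _ _)]rmorphM [to_wloc (r * _)]rmorphM.
exact/mulr_cancel_mid/mono_coef2E.
Qed.

(** Summing over the whole group avoids coset representatives, at the price of the integer factor in
    [orbsum_monopole]. *)
Definition orbsum A p : diffop k v := \sum_(s | in_Sv s) mono (s @: A) (permw s p).

Lemma orbsum_is_additive A : zmod_morphism (orbsum A).
Proof.
move=> p q; rewrite /orbsum -sumrB; apply: eq_bigr => s _.
by rewrite rmorphB raddfB.
Qed.
HB.instance Definition _ A :=
  GRing.isZmodMorphism.Build wpoly (diffop k v) (orbsum A) (orbsum_is_additive A).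

Lemma orbsum_perm s A p : in_Sv s -> orbsum (s @: A) (permw s p) = orbsum A p.
Proof.
move=> hs; rewrite [RHS]/orbsum (reindex_inj (mulgI s)) /=.
apply: eq_big => [s'|s' _]; first by rewrite in_SvMl.
rewrite permwM -imset_comp; congr (mono _ _); apply: eq_imset => t.
by rewrite /= permM.
Qed.

Lemma orbsum_wpoly A p q :
  (forall s, in_Sv s -> permw s p = p) -> of_wpoly p * orbsum A q = orbsum A (p * q).
Proof.
move=> hp; rewrite /orbsum mulr_sumr; apply: eq_bigr => s hs.
by rewrite mono_wpoly rmorphM /= hp.
Qed.


End Monomials.

(** * Products of orbit sums *)

Section OrbitProducts.
Variables (k : comNzRingType) (Q : quiver) (v : vertex Q -> nat).
Local Notation J := (windex v).
Local Notation R := (base_ring k Q).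
Local Notation wpoly := (pring R J).
Local Notation w := (@pvar R J).
Local Notation mlink := (link (@tag _ _) (@pconst R J) w).
Implicit Types (s : {perm J}) (A : {set J}) (t a : J) (p q : wpoly).

(** The permutation in the first sum is written as [s' * s]: here [s'] fixes the position of the new
    point relative to [A], and [s] moves both together. *)
Lemma orbsum_mul t A n q :
  orbsum [set t] (w t ^+ n) * orbsum A q =
  \sum_(s' | in_Sv s') \sum_(s | in_Sv s)
    mono2 (s (s' t)) (s @: A)
      (permw s (w (s' t) ^+ n * shift (indic [set s' t]) q)).
Proof.
rewrite /orbsum big_distrlr /= exchange_big /= [RHS]exchange_big /=.
apply: eq_bigr => s hs; rewrite (reindex_inj (mulIg s)) /=.
apply: eq_big => [s'|s' _]; first by rewrite in_SvM.
rewrite imset_set1 permM rmorphXn /= permw_var permM mono_mul.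
by rewrite rmorphM rmorphXn /= permw_var -shift_permw imset_set1.
Qed.

Lemma horner_shift (G : {poly wpoly}) t p :
  \sum_(n < size G) w t ^+ n * shift (indic [set t]) (G`_n * p) =
  (map_poly (shift (indic [set t])) G).[w t] * shift (indic [set t]) p.
Proof.
rewrite (@horner_coef_wide _ (size G)) ?size_poly // mulr_suml.
by apply: eq_bigr => n _; rewrite rmorphM coef_map mulrCA mulrA.
Qed.

(* The factors of [collision_poly] kill the terms in which the new variable
   coincides with an old one, and clear the new denominators in the others. *)
Lemma orbsum_step (H : {poly wpoly}) A t p :
  (forall n, polys_in A H`_n) -> polys_in A p -> t \notin A ->
  let G := H * collision_poly k (tag t) A in
  \sum_(n < size G) orbsum [set t] (w t ^+ n) * orbsum A (G`_n * p) =
  orbsum (t |: A) (H.[w t] * (mlink t A * p)) *+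
    #|[pred s : {perm J} | in_Sv s && (s t \notin A)]|.
Proof.
move=> hH hp tA G; under eq_bigr do rewrite orbsum_mul.
rewrite exchange_big /= -sumr_const (bigID (fun s : {perm J} => s t \in A)) /=.
rewrite [X in X + _]big1 ?add0r => [|s' /andP[hs' s'A]].
  apply: eq_bigr => s' /andP[hs' s'A].
  have -> : orbsum (t |: A) (H.[w t] * (mlink t A * p)) =
      orbsum (s' t |: A) (H.[w (s' t)] * (mlink (s' t) A * p)).
    (* This transposition fixes [A] pointwise and takes [t] to [s' t], so all surviving terms are
       equal. *)
    pose u := tperm t (s' t).
    have hu : in_Sv u by apply: in_Sv_tperm; rewrite tag_in_Sv.
    have uA : {in A, u =1 id} := tperm_fix tA s'A.
    have ep : permw u p = p := permw_polys_in uA hp.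
    have el : permw u (mlink t A) = mlink (s' t) A.
      by rewrite permw_link // tpermL (imset_fix uA).
    have eH : permw u H.[w t] = H.[w (s' t)].
      rewrite !horner_coef rmorph_sum; apply: eq_bigr => n _.
      by rewrite rmorphM rmorphXn /= permw_var tpermL (permw_polys_in uA (hH n)).
    have <- : u @: (t |: A) = s' t |: A by rewrite imsetU1 tpermL (imset_fix uA).
    have <- : permw u (H.[w t] * (mlink t A * p)) = H.[w (s' t)] * (mlink (s' t) A * p).
      by rewrite 2!rmorphM /= ep el eH.
    by rewrite orbsum_perm.
  rewrite exchange_big; apply: eq_bigr => s hs.
  rewrite -raddf_sum -rmorph_sum /= horner_shift (shift_polys_in s'A hp).
  (* The coefficients of [G] involve only variables of [A], which the shift at a point outside [A]
     leaves alone. *)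
  have -> : map_poly (shift (indic [set s' t])) G = G.
    apply/polyP => n; rewrite coef_map /=; apply: (shift_polys_in s'A).
    rewrite coefM; apply: subring_gen_sum => j _; apply: subring_genM.
      exact: hH.
    exact: collision_poly_polys_in.
  rewrite /G hornerM -(tag_in_Sv t hs') collision_polyE mulrAC rmorphM /=.
  rewrite permw_collision // mono2_collision; last first.
    by rewrite mem_imset //; exact: perm_inj.
  by rewrite -permw_link // -rmorphM -imsetU1 mulrAC mulrA.
rewrite exchange_big big1 // => s hs.
rewrite -raddf_sum -rmorph_sum /= horner_shift.
(* Now [s' t] lies in [A], and the shifted collision polynomial has $w_{s'(t)}$ as a root. *)
have -> : (map_poly (shift (indic [set s' t])) G).[w (s' t)] = 0.
  have -> : map_poly (shift (indic [set s' t])) G = map_poly (shift (indic [set s' t])) H *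
      map_poly (shift (indic [set s' t])) (collision_poly k (tag t) A) by exact: rmorphM.
  have := @collision_poly_shift k Q v (s' t) A s'A; rewrite (tag_in_Sv t hs') hornerM.
  by move=> e0; rewrite [X in _ * X]e0 mulr0.
by rewrite mul0r rmorph0 raddf0.
Qed.

End OrbitProducts.

(** * Orbit sums in the spherical subalgebra *)

Section Spherical.
Variables (k : comNzRingType) (rat_to_k : {rmorphism rat -> k}).
Variables (Q : quiver) (v : vertex Q -> nat).
Local Notation J := (windex v).
Local Notation R := (base_ring k Q).
Local Notation wpoly := (pring R J).
Local Notation w := (@pvar R J).
Local Notation mlink := (link (@tag _ _) (@pconst R J) w).
Local Notation mordprod := (ordprod (@tag _ _) (@pconst R J) w).
Implicit Types (s : {perm J}) (A : {set J}) (t a : J) (p q : wpoly) (m : vertex Q -> nat).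

Lemma of_wpoly_is_additive : zmod_morphism (@of_wpoly k Q v).
Proof. by move=> p q; rewrite /of_wpoly rmorphB [LHS]monalgUB. Qed.
Lemma of_wpoly_is_monoid_morphism : monoid_morphism (@of_wpoly k Q v).
Proof. by split=> [|p q]; [rewrite /of_wpoly rmorph1|exact: wpolyM]. Qed.
HB.instance Definition _ := GRing.isZmodMorphism.Build wpoly (diffop k v)
  (@of_wpoly k Q v) of_wpoly_is_additive.
HB.instance Definition _ := GRing.isMonoidMorphism.Build wpoly (diffop k v)
  (@of_wpoly k Q v) of_wpoly_is_monoid_morphism.

Definition QF_alg : set (diffop k v) := subring_gen (range (of_base v) `|` elemsQF k v).

Lemma QF_base c : QF_alg (of_base v c).
Proof. by apply: subring_gen_in; left; exists c. Qed.

Lemma QF_Q i r : (0 < r)%N -> QF_alg (elemQ k v i r).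
Proof. by move=> r0; apply: subring_gen_in; right; exists i, r; split => //; left. Qed.

Lemma QF_F i r : (0 < r)%N -> QF_alg (elemF k v i r).
Proof. by move=> r0; apply: subring_gen_in; right; exists i, r; split => //; right. Qed.

Definition recip n : R := pconst _ (rat_to_k (n%:R^-1)).

Lemma recipK n : (0 < n)%N -> recip n *+ n = 1.
Proof.
move=> n0; rewrite /recip -rmorphMn -rmorphMn -mulr_natr mulVf ?rmorph1 //.
by rewrite Num.Theory.pnatr_eq0 -lt0n.
Qed.

(** Integer multiplicities of sums over permutations are removed by means of $1/n\in\Bbbk$. *)
Lemma QF_divn n x : (0 < n)%N -> QF_alg (x *+ n) -> QF_alg x.
Proof.
move=> n0 hx.
have -> : x = of_base v (recip n) * (x *+ n).
  rewrite mulrnAr -mulrnAl /of_base -rmorphMn -rmorphMn (recipK n0).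
  by rewrite !rmorph1 mul1r.
by apply: subring_genM => //; exact: QF_base.
Qed.

Lemma corner_size m s : (forall i, (m i <= v i)%N) -> in_Sv s ->
  has_size m (s @: corner v m).
Proof.
move=> mv hs; apply/forallP => i; apply/eqP.
have -> : [set j in s @: corner v m | tag j == i]%SET
    = s @: [set j in corner v m | tag j == i].
  apply/setP => j; rewrite inE; apply/andP/imsetP => [[/imsetP[a aC ->] e]|[a]].
    by exists a; rewrite // inE aC -(tag_in_Sv a hs).
  by rewrite inE => /andP[aC e] ->; rewrite imset_f // tag_in_Sv.
rewrite card_imset; last exact: perm_inj.
pose g (r : 'I_(m i)) : J := Tagged (fun i => 'I_(v i)) (widen_ord (mv i) r).
rewrite -[RHS]card_ord -cardsT -(@card_imset _ _ g); last first.
  move=> r r' /eqP; rewrite eq_Tagged /= => /eqP e; apply: val_inj.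
  by have /(congr1 val) := e.
congr #|pred_of_set _|; apply/setP => -[i' r]; rewrite !inE /=.
apply/andP/imsetP => [[rm /eqP e]|[r' _]].
  rewrite /= in e; subst i'.
  by exists (Ordinal rm) => //; congr existT; apply: val_inj.
move=> e; have e' : i' = i by have := congr1 tag e.
move: r e; rewrite {}e' => r /eqP; rewrite eq_Tagged => /eqP /= ->.
by rewrite eqxx /=.
Qed.

Definition corner_stab m := #|[pred s : {perm J} | in_Sv s && (s @: corner v m == corner v m)]|.

Lemma corner_stab_gt0 m : (0 < corner_stab m)%N.
Proof.
apply/card_gt0P; exists 1%g; rewrite inE in_Sv1 /=; apply/eqP.
by apply: imset_fix => t _; rewrite perm1.
Qed.

(** The permutations carrying the corner to a given [G] form a coset of its stabilizer, and all of
    them contribute the same summand. *)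
Lemma orbsum_monopole m (f : wpoly) : Lambda1 m f -> (forall i, (m i <= v i)%N) ->
  orbsum (corner v m) f = monopole m f *+ corner_stab m.
Proof.
move=> Lf mv; rewrite /orbsum /monopole -sumrMnl.
rewrite (partition_big (fun s : {perm J} => s @: corner v m) (has_size m)) /=; last first.
  by move=> s hs; exact: corner_size.
apply: eq_bigr => G _.
transitivity (\sum_(s | in_Sv s && (s @: corner v m == G)) mono G (restr m f G)).
  by apply: eq_bigr => s /andP[hs /eqP <-]; rewrite restrE.
case: (pickP [pred s : {perm J} | in_Sv s && (s @: corner v m == G)]) => [s0|h].
  move=> /andP[hs0 /eqP eG]; rewrite monoE /corner_stab -sumr_const.
  rewrite (reindex_inj (mulIg s0)) /=; apply: eq_bigl => s; rewrite inE in_SvM //.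
  congr (_ && _); rewrite -eG.
  have -> : (s * s0)%g @: corner v m = s0 @: (s @: corner v m).
    by rewrite -imset_comp; apply: eq_imset => t; rewrite /= permM.
  by rewrite (inj_eq (imset_inj (@perm_inj _ s0))).
(* If no permutation reaches [G], the fibre is empty and [restr] takes its default value, so both
   sides vanish. *)
have r0 : restr m f G = 0.
  by rewrite /restr; case: pickP => // s; have /= -> := h s.
rewrite big_pred0 // -[monalg.mkmalgU _ _](monoE (restr m f G) G) r0.
by rewrite [mono G 0]raddf0 mul0rn.
Qed.

Lemma corner_alpha t : tagged t = 0%N :> nat ->
  corner v (alpha (tag t)) = [set t]%SET.
Proof.
case: t => i r /= r0; apply/setP => -[i' r']; rewrite !inE /alpha /=.
case: (eqVneq i' i) => [e|ne].
  by subst i'; rewrite eq_Tagged /= ltnS leqn0 -r0.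
by rewrite ltn0; apply/esym/eqP => /(congr1 tag)/= /eqP; rewrite (negbTE ne).
Qed.

Lemma Lambda1_alphaX t n : tagged t = 0%N :> nat ->
  Lambda1 (alpha (tag t)) (w t ^+ n).
Proof.
move=> t0 u _; rewrite corner_alpha // => /setP/(_ (u t)).
by rewrite imset_set1 !inE eqxx => /esym/eqP e; rewrite rmorphXn /= permw_var e.
Qed.

(** A transposition moves [t] to the first position of its colour, which exhibits a multiple of
    $F_i^{(n+1)}$. *)
Lemma QF_orbsum1 t n : QF_alg (orbsum [set t] (w t ^+ n)).
Proof.
have := QF_F (tag t) (ltn0Sn n); rewrite /elemF.
case: insubP => [s _ s0 /=|]; last first.
  by rewrite -leqNgt => v0; have := leq_trans (ltn_ord (tagged t)) v0; rewrite ltn0.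
set t0 : J := Tagged (fun i => 'I_(v i)) (s : 'I_(v (tag t))) => hF.
have hu : in_Sv (tperm t0 t) by exact: in_Sv_tperm.
rewrite -(orbsum_perm _ _ hu) imset_set1 tpermR rmorphXn /= permw_var tpermR.
rewrite -(corner_alpha (t := t0)) // orbsum_monopole; last first.
- by move=> i; rewrite /alpha; case: eqP => // ->; exact: leq_trans (ltn_ord (s : 'I_(v (tag t)))).
- exact: Lambda1_alphaX.
exact: subring_genMn.
Qed.

(** The collision factors needed by [orbsum_step] have coefficients in the variables of [A], and the
    hypothesis admits any such multiplier [q]. *)
Lemma orbsum_step_QF A t p g : t \notin A -> polys_in A p ->
  (forall q, polys_in A q -> QF_alg (orbsum A (q * p))) ->
  polys_in (t |: A) g -> QF_alg (orbsum (t |: A) (g * (mlink t A * p))).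
Proof.
move=> tA hp IH /polys_in_horner[H hH ->].
apply: (@QF_divn #|[pred s : {perm J} | in_Sv s && (s t \notin A)]|).
  by apply/card_gt0P; exists 1%g; rewrite inE in_Sv1 perm1.
rewrite -orbsum_step //; apply: subring_gen_sum => n _; apply: subring_genM.
  exact: QF_orbsum1.
apply: IH; rewrite coefM; apply: subring_gen_sum => j _; apply: subring_genM.
  exact: hH.
exact: collision_poly_polys_in.
Qed.

Lemma polys_in_link t A : polys_in (t |: A) (mlink t A).
Proof.
apply: subring_gen_prod => a aA; apply: subring_gen_prod => h _.
have wt : polys_in (t |: A) (w t) by apply: polys_in_var; rewrite !inE eqxx.
have wa : polys_in (t |: A) (w a) by apply: polys_in_var; rewrite !inE aA orbT.
by case: h => e; apply: subring_genD; [exact: subring_genB|exact: polys_in_const|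
  exact: subring_genB|exact: polys_in_const].
Qed.

Lemma polys_in_ordprod (ts : seq J) : polys_in [set a in ts] (mordprod ts).
Proof.
elim: ts => [|t ts IH] /=; first exact: subring_gen1.
have -> : [set a in t :: ts]%SET = t |: [set a in ts]%SET.
  by apply/setP => a; rewrite !inE.
apply: subring_genM; first exact: polys_in_link.
by apply: polys_in_sub IH; exact: finset.subsetUr.
Qed.

Lemma QF_polys0 p : polys_in finset.set0 p -> QF_alg (of_wpoly p).
Proof.
elim=> [|_ [[c _ <-]|[t tS <-]]|q r _ hq _ hr|q r _ hq _ hr].
- by rewrite rmorph1; exact: subring_gen1.
- exact: QF_base.
- by rewrite /= inE in tS.
- by rewrite rmorphB; exact: subring_genB.
by rewrite rmorphM; exact: subring_genM.
Qed.

(** The points are added one by one, starting from the end of the list; each new point contributes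
    its link with those already present. *)
Lemma QF_orbsum_ordprod (ts : seq J) g : uniq ts -> polys_in [set a in ts] g ->
  QF_alg (orbsum [set a in ts] (g * mordprod ts)).
Proof.
elim: ts g => [|t ts IH] g /=.
  have -> : [set a in [::]]%SET = finset.set0 :> {set J} by apply/setP => a; rewrite !inE.
  move=> _; rewrite mulr1 => hg.
  have e0 : finset.set0 = corner v (fun=> 0%N) by apply/setP => t; rewrite !inE.
  have Lg : Lambda1 (fun=> 0%N) g.
    by move=> s _ _; apply: permw_polys_in hg => t; rewrite inE.
  rewrite e0 orbsum_monopole // monopole0 //; apply: subring_genMn.
  exact: QF_polys0.
have -> : [set a in t :: ts]%SET = t |: [set a in ts]%SET.
  by apply/setP => a; rewrite !inE.
move=> /andP[tts us] hg; apply: orbsum_step_QF => //.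
- by rewrite inE.
- exact: polys_in_ordprod.
by move=> q hq; exact: IH.
Qed.

End Spherical.

(** * Invariants and power sums *)

(* The logarithmic derivative of a product of factors 1 - x X, modulo X^N. *)
Lemma deriv_prod_trunc (K : comNzRingType) (l : seq K) (N : nat) :
  let P := \prod_(x <- l) (1 - x%:P * 'X) in
  exists C, P^`() + P * (\sum_(x <- l) \sum_(j < N) (x ^+ j.+1)%:P * 'X^j) = C * 'X^N.
Proof.
elim: l => [|y l /= [C hC]] /=; first by exists 0; rewrite !big_nil derivC mulr0 addr0 mul0r.
rewrite !big_cons; set P := \prod_(x <- l) _ in hC *; set S := \sum_(x <- l) _ in hC *.
have geo : (1 - y%:P * 'X) * (\sum_(j < N) (y ^+ j.+1)%:P * 'X^j)
    = y%:P - (y ^+ N.+1)%:P * 'X^N.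
  elim: N {hC S} => [|N IH]; first by rewrite big_ord0 mulr0 expr0 mulr1 expr1 subrr.
  rewrite big_ord_recr mulrDr IH /= mulrBl mul1r addrA subrK [y ^+ N.+2]exprS polyCM.
  by rewrite mulrACA -exprS.
exists ((1 - y%:P * 'X) * C - (y ^+ N.+1)%:P * P).
rewrite derivM; have -> : (1 - y%:P * 'X)^`() = - y%:P :> {poly K}.
  by rewrite derivB derivM !derivC derivX mul0r !add0r mulr1.
set F := 1 - _ in geo *; set G := \sum_(j < N) _ in geo *; set e := (y ^+ N.+1)%:P in geo *.
transitivity (F * (P^`() + P * S) + (F * G - y%:P) * P); first by ring.
by rewrite hC geo; ring.
Qed.

(** Coefficient of $X^r$ in [deriv_prod_trunc] with $N=r+1$, to which the error term $CX^{r+1}$ does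
    not contribute. *)
Lemma newton (K : comNzRingType) (l : seq K) (r : nat) :
  let q := \prod_(x <- l) (1 - x%:P * 'X) in
  q`_r.+1 *+ r.+1 = - \sum_(j < r.+1) q`_(r - j) * \sum_(x <- l) x ^+ j.+1.
Proof.
move=> q; have [C] := deriv_prod_trunc l r.+1; rewrite -/q.
move=> /(congr1 (fun p : {poly K} => p`_r)); rewrite coefMXn ltnSn coefD coef_deriv.
move=> /eqP; rewrite addr_eq0 => /eqP ->; congr (- _).
rewrite coefMr; apply: eq_bigr => j _; congr (_ * _).
rewrite coef_sum; apply: eq_bigr => x _; rewrite coef_sum (bigD1 j) //= coefCM coefXn eqxx.
rewrite mulr1 big1 ?addr0 // => i ne; rewrite coefCM coefXn eq_sym.
by rewrite (negbTE (_ : nat_of_ord i != j)) // mulr0.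
Qed.

Section PowerSums.
Variables (k : comNzRingType) (rat_to_k : {rmorphism rat -> k}).
Variables (Q : quiver) (v : vertex Q -> nat).
Local Notation J := (windex v).
Local Notation R := (base_ring k Q).
Local Notation wpoly := (pring R J).
Local Notation w := (@pvar R J).
Implicit Types (s : {perm J}) (A : {set J}) (t a : J) (p q : wpoly) (i : vertex Q).

Definition psum i r : wpoly := \sum_(j | tag j == i) w j ^+ r.

Lemma psumE i r : psum i r = \sum_(s < v i) w (Tagged (fun i => 'I_(v i)) s) ^+ r.
Proof.
transitivity (\sum_(i' | i' == i) \sum_(s < v i') w (Tagged (fun i => 'I_(v i)) s) ^+ r);
  last by rewrite big_pred1_eq.
rewrite sig_big_dep /=; apply: eq_big => [[i' s]|[i' s] _] //=.
by rewrite andbT.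
Qed.

(** In Newton's identity the highest power sum has coefficient $q_0=1$, so it can be solved for
    without division. *)
Lemma QF_psum i r : (0 < r)%N -> QF_alg (of_wpoly (psum i r)).
Proof.
have [n] := ubnP r; elim: n r => // n IH [//|r] ltrn _.
pose l := [seq w (Tagged (fun i => 'I_(v i)) j) | j <- index_enum 'I_(v i)].
have qE r' : of_wpoly (\prod_(x <- l) (1 - x%:P * 'X))`_r' = elemQ k v i r'.
  by rewrite /elemQ big_map.
have pE r' : \sum_(x <- l) x ^+ r' = psum i r' by rewrite psumE big_map.
have q0 : (\prod_(x <- l) (1 - x%:P * 'X))`_0 = 1.
  rewrite -horner_coef0 horner_prod big1 // => x _.
  by rewrite hornerD hornerN hornerMX mulr0 subr0 hornerC.
have := newton l r; cbv zeta; rewrite big_ord_recr /= subnn q0 mul1r pE opprD.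
move=> /eqP; rewrite eq_sym subr_eq [_ + psum _ _]addrC -subr_eq => /eqP <-.
rewrite rmorphB rmorphN /= rmorphMn /= qE; apply: subring_genB; last first.
  by apply: subring_genMn; exact: QF_Q.
apply: subring_genN; rewrite rmorph_sum; apply: subring_gen_sum => j _.
rewrite rmorphM /= pE qE; apply: subring_genM.
  by apply: QF_Q; rewrite subn_gt0.
by apply: IH => //; exact: leq_ltn_trans (ltn_ord j) _.
Qed.

End PowerSums.

Lemma pring_monomials (R : comNzRingType) (T : finType) (p : pring R T) :
  exists (r : seq (R * (T -> nat))),
    p = \sum_(x <- r) pconst T x.1 * \prod_t pvar R t ^+ x.2 t.
Proof.
exists [seq (mpoly.mcoeff u p, fun t => u (enum_rank t)) | u <- mpoly.msupp p].
rewrite big_map [LHS]mpolyE; apply: eq_bigr => u _ /=.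
rewrite -mul_mpolyC mpolyXE_id; congr (_ * _).
rewrite (reindex (@enum_rank T)) //=.
by exists enum_val => t _; [exact: enum_rankK|exact: enum_valK].
Qed.

(** * Invariants of the pointwise stabilizer of a set of points *)

Section Reynolds.
Variables (k : comNzRingType) (rat_to_k : {rmorphism rat -> k}).
Variables (Q : quiver) (v : vertex Q -> nat) (A : {set windex v}).
Local Notation J := (windex v).
Local Notation R := (base_ring k Q).
Local Notation wpoly := (pring R J).
Local Notation w := (@pvar R J).
Implicit Types (s : {perm J}) (t a : J) (p q : wpoly) (i : vertex Q).

(** The power sums include the variables of [A]; being invariant under all of $S_{\mathbf v}$, they
    can later be pulled out of orbit sums. *)
Definition psum_alg : set wpoly := subring_gen
  (range (@pconst R J) `|` [set w t | t in [set` A]] `|`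
   [set psum k v i r | i in setT & r in [set r | (0 < r)%N]]).

Lemma psum_alg_polys p : polys_in A p -> psum_alg p.
Proof. by apply: subring_gen_sub => x hx; apply: subring_gen_in; left. Qed.

Lemma psum_alg_divn n p : (0 < n)%N -> psum_alg (p *+ n) -> psum_alg p.
Proof.
move=> n0 hp; have -> : p = pconst J (recip rat_to_k Q n) * (p *+ n).
  by rewrite mulrnAr -mulrnAl -rmorphMn (recipK _ _ n0) rmorph1 mul1r.
by apply: subring_genM => //; apply: psum_alg_polys; exact: polys_in_const.
Qed.

Definition fixperm : pred {perm J} :=
  [pred s : {perm J} | in_Sv s && [forall a in A, s a == a]].

Definition reynolds p : wpoly := \sum_(s | fixperm s) permw s p.

Lemma fixpermP s : reflect (in_Sv s /\ {in A, s =1 id}) (fixperm s).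
Proof.
apply: (iffP andP) => -[hs h]; split=> //.
  by move=> a aA; have /forall_inP/(_ a aA)/eqP := h.
by apply/forall_inP => a aA; apply/eqP; exact: h.
Qed.

Lemma fixperm_notin s t : fixperm s -> (s t \in A) = (t \in A).
Proof.
move=> /fixpermP[_ hs]; apply/idP/idP => h; last by rewrite hs.
by rewrite -(perm_inj (hs _ h)).
Qed.

Lemma reynolds_perm s p : fixperm s -> reynolds (permw s p) = reynolds p.
Proof.
move=> /fixpermP[hs sA]; rewrite [RHS]/reynolds (reindex_inj (mulgI s)) /=.
apply: eq_big => [s'|s' _]; last by rewrite permwM.
rewrite /fixperm /= in_SvMl //; congr (_ && _); apply: eq_forallb => a.
by case: (boolP (a \in A)) => //= aA; rewrite permM sA.
Qed.

Definition compl_mon (e : J -> nat) : wpoly := \prod_(t | t \notin A) w t ^+ e t.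

Lemma compl_psum i r : (0 < r)%N ->
  psum_alg (\sum_(t | (t \notin A) && (tag t == i)) w t ^+ r).
Proof.
move=> r0; have -> : \sum_(t | (t \notin A) && (tag t == i)) w t ^+ r
    = psum k v i r - \sum_(t | (t \in A) && (tag t == i)) w t ^+ r.
  rewrite /psum (bigID (mem A) (fun t => tag t == i)) /= addrC.
  rewrite [X in _ + X - _](eq_bigl (fun t => (t \in A) && (tag t == i))); last first.
    by move=> t; rewrite andbC.
  by rewrite addrK; apply: eq_bigl => t; rewrite andbC.
apply: subring_genB.
  by apply: subring_gen_in; right; exists i => //; exists r.
apply: psum_alg_polys; apply: subring_gen_sum => t /andP[tA _].
by apply: subring_genX; exact: polys_in_var.
Qed.

(** Each [s] in the stabilizer permutes the points of colour [i] outside [A], so the power sum moves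
    inside the sum over [s]. *)
Lemma compl_psum_reynolds i r p :
  (\sum_(t | (t \notin A) && (tag t == i)) w t ^+ r) * reynolds p =
  \sum_(t | (t \notin A) && (tag t == i)) reynolds (w t ^+ r * p).
Proof.
rewrite mulr_sumr exchange_big /=; apply: eq_bigr => s hs.
rewrite (reindex_inj (@perm_inj _ s)) /= mulr_suml.
apply: eq_big => [t|t _].
  by rewrite fixperm_notin //; have /fixpermP[hs' _] := hs; rewrite tag_in_Sv.
by rewrite rmorphM rmorphXn /= permw_var.
Qed.

Lemma permw_compl_mon s e :
  fixperm s -> permw s (compl_mon (e \o s)) = compl_mon e.
Proof.
move=> hs; rewrite /compl_mon rmorph_prod [RHS](reindex_inj (@perm_inj _ s)) /=.
apply: eq_big => [t|t _]; first by rewrite fixperm_notin.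
by rewrite rmorphXn /= permw_var.
Qed.

(* A power sum times the orbit sum of a monomial without w_b is the sum, over the w_t
   of the same colour, of the orbit sums of the products: those with t in the support
   have smaller support, the others are conjugate to the target. *)
Lemma reynolds_compl_mon e : psum_alg (reynolds (compl_mon e)).
Proof.
have [n] := ubnP #|[set t | (t \notin A) && (e t != 0%N)]%SET|.
elim: n e => // n IH e; rewrite ltnS => len.
have [e0|[b]] := set_0Vmem [set t | (t \notin A) && (e t != 0%N)]%SET.
  have -> : compl_mon e = 1.
    rewrite /compl_mon big1 // => t tA; move/setP/(_ t): e0; rewrite !inE tA /=.
    by move/negbFE/eqP ->.
  rewrite /reynolds; apply: subring_gen_sum => s _; rewrite rmorph1.
  exact: subring_gen1.
rewrite inE => /andP[bA eb].
(* Erase the exponent at [b]; [ee t] then adds the erased exponent at [t], so that [ee b] is [e]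
   again. *)
pose e0 t := if t == b then 0%N else e t.
pose ee t u := (e0 u + (u == t) * e b)%N.
have eeM t : t \notin A -> w t ^+ e b * compl_mon e0 = compl_mon (ee t).
  move=> tA; rewrite /compl_mon (bigD1 t) //= [RHS](bigD1 t) //= mulrA -exprD.
  rewrite -(_ : ee t t = (e b + e0 t)%N); last by rewrite /ee eqxx mul1n addnC.
  congr (_ * _); apply: eq_bigr => u /andP[_ ut].
  by rewrite /ee (negbTE ut) mul0n addn0.
have eb_e : compl_mon e = compl_mon (ee b).
  apply: eq_bigr => u _; rewrite /ee /e0; case: eqP => [->|]; rewrite ?mul1n //.
  by rewrite mul0n addn0.
have small (f : J -> nat) : (forall t, f t != 0%N -> e0 t != 0%N) ->
    psum_alg (reynolds (compl_mon f)).
  move=> hf; apply: IH; apply: leq_trans len; apply: proper_card; apply/properP.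
  split; last first.
    exists b; first by rewrite inE bA.
    by rewrite inE negb_and; apply/orP; right; apply/negP => /hf; rewrite /e0 eqxx.
  apply/fintype.subsetP => t; rewrite !inE => /andP[-> /hf]; rewrite /e0 /=.
  by case: (t =P b).
have hsum : psum_alg (\sum_(t | (t \notin A) && (tag t == tag b)) reynolds (compl_mon (ee t))).
  have <- : (\sum_(t | (t \notin A) && (tag t == tag b)) w t ^+ e b) * reynolds (compl_mon e0)
     = \sum_(t | (t \notin A) && (tag t == tag b)) reynolds (compl_mon (ee t)).
    by rewrite compl_psum_reynolds; apply: eq_bigr => t /andP[tA _]; rewrite eeM.
  by apply: subring_genM; [apply: compl_psum; rewrite lt0n|exact: small].
have orb t : t \notin A -> tag t = tag b -> e0 t = 0%N ->
    reynolds (compl_mon (ee t)) = reynolds (compl_mon e).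
  move=> tA tb e0t; have hu : fixperm (tperm b t).
    apply/fixpermP; split; [exact: in_Sv_tperm|exact: tperm_fix].
  rewrite -(permw_compl_mon (ee t) hu) (reynolds_perm _ hu) eb_e.
  congr (reynolds _).
  have e0b : e0 b = 0%N by rewrite /e0 eqxx.
  apply: eq_bigr => u _; congr (_ ^+ _); rewrite /= /ee; case: tpermP => [->|->|ub ut].
  - by rewrite e0t e0b !eqxx.
  - by rewrite e0t e0b eq_sym.
  by move/eqP/negbTE: ub => ->; move/eqP/negbTE: ut => ->.
pose P t := [&& t \notin A, tag t == tag b & e0 t == 0%N].
apply: (@psum_alg_divn #|P|).
  by apply/card_gt0P; exists b; rewrite [b \in P]/(P b) /P bA /e0 !eqxx.
rewrite -sumr_const.
have -> : \sum_(t in P) reynolds (compl_mon e) =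
    \sum_(t | (t \notin A) && (tag t == tag b)) reynolds (compl_mon (ee t)) -
    \sum_(t | [&& t \notin A, tag t == tag b & e0 t != 0%N]) reynolds (compl_mon (ee t)).
  rewrite [X in X - _](bigID (fun t => e0 t == 0%N)) /=.
  rewrite [X in _ + X - _](eq_bigl (fun t => [&& t \notin A, tag t == tag b & e0 t != 0%N])).
    rewrite addrK; apply: eq_big => [t|t]; first by rewrite [t \in P]/(P t) /P andbA.
    by rewrite [t \in P]/(P t) => /and3P[tA /eqP tb /eqP e0t]; rewrite orb.
  by move=> t; rewrite andbA.
apply: subring_genB => //; apply: subring_gen_sum => t /and3P[_ _ e0t].
by apply: small => u; rewrite /ee; case: (u =P t) => [->|_]; rewrite ?mul0n ?addn0.
Qed.

(** In each monomial the part in the variables of [A] is fixed by the group and factors out, which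
    leaves [reynolds_compl_mon]. *)
Lemma reynolds_psum_alg p : psum_alg (reynolds p).
Proof.
have [r ->] := pring_monomials p.
have -> (F : R * (J -> nat) -> wpoly) :
    reynolds (\sum_(x <- r) F x) = \sum_(x <- r) reynolds (F x).
  rewrite /reynolds [RHS]exchange_big; apply: eq_bigr => s _; exact: rmorph_sum.
apply: subring_gen_sum => -[c e] _ /=.
have -> : reynolds (pconst J c * \prod_t w t ^+ e t) =
    pconst J c * (\prod_(t in A) w t ^+ e t) * reynolds (compl_mon e).
  rewrite /reynolds [RHS]mulr_sumr; apply: eq_bigr => s /fixpermP[_ sA].
  rewrite [LHS]rmorphM /= permw_const -[RHS]mulrA; congr (_ * _).
  rewrite (bigID (mem A)) rmorphM; congr (_ * _).
  rewrite rmorph_prod; apply: eq_bigr => t tA.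
  by rewrite rmorphXn /= permw_var sA.
apply: subring_genM; last exact: reynolds_compl_mon.
apply: psum_alg_polys; apply: subring_genM; first exact: polys_in_const.
by apply: subring_gen_prod => t tA; apply: subring_genX; exact: polys_in_var.
Qed.

Lemma fixed_psum_alg p : (forall s, fixperm s -> permw s p = p) -> psum_alg p.
Proof.
move=> hp; apply: (@psum_alg_divn #|fixperm|).
  apply/card_gt0P; exists 1%g; apply/fixpermP; split; first exact: in_Sv1.
  by move=> a _; rewrite perm1.
by rewrite -sumr_const -(eq_bigr _ hp); exact: reynolds_psum_alg.
Qed.

End Reynolds.

(** * The theorem *)

Section Transport.
Variables (R : comNzRingType) (T T' : finType) (e : T -> T').

Definition prename (p : pring R T) : pring R T' :=
  comp_mpoly [tuple pvar R (e (enum_val i)) | i < #|T|] p.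

Lemma prename_zmod : zmod_morphism prename.
Proof. by move=> p q; rewrite /prename [LHS]raddfB. Qed.
Lemma prename_monoid : monoid_morphism prename.
Proof.
by split=> [|p q]; rewrite /prename; [rewrite [LHS]rmorph1|rewrite [LHS]rmorphM].
Qed.
HB.instance Definition _ :=
  GRing.isZmodMorphism.Build (pring R T) (pring R T') prename prename_zmod.
HB.instance Definition _ :=
  GRing.isMonoidMorphism.Build (pring R T) (pring R T') prename prename_monoid.

Lemma prename_var t : prename (pvar R t) = pvar R (e t).
Proof. by rewrite /prename /pvar comp_mpolyXU -tnth_nth tnth_mktuple enum_rankK. Qed.

Lemma prename_const c : prename (pconst T c) = pconst T' c.
Proof. exact: comp_mpolyC. Qed.

Lemma prename_polys_in p : polys_in (e @: [set: T]%SET) (prename p).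
Proof.
elim/pring_ind: p => [c|t|p q hp hq|p q hp hq].
- by rewrite prename_const; exact: polys_in_const.
- by rewrite prename_var; apply: polys_in_var; rewrite imset_f.
- by rewrite rmorphD; exact: subring_genD.
by rewrite rmorphM; exact: subring_genM.
Qed.

End Transport.

(** * Multiples of monopole operators in the spherical subalgebra *)

Section Fundamental.
Variables (k : comNzRingType) (rat_to_k : {rmorphism rat -> k}).
Variables (Q : quiver) (v : vertex Q -> nat).
Local Notation J := (windex v).
Local Notation R := (base_ring k Q).
Local Notation wpoly := (pring R J).
Local Notation w := (@pvar R J).
Local Notation QF_alg := (@QF_alg k Q v).
Implicit Types (s : {perm J}) (A : {set J}) (t a : J) (p q : wpoly) (m : vertex Q -> nat).

Lemma monopole_scale c m (f : wpoly) :
  of_base v c * monopole m f = monopole m (pconst _ c * f).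
Proof.
have monopoleE f' : monopole m f' = \sum_(G : {set J} | has_size m G) mono G (restr m f' G).
  by apply: eq_bigr => G _; rewrite monoE.
rewrite !monopoleE mulr_sumr; apply: eq_bigr => G _; rewrite mono_wpoly.
congr (mono _ _); rewrite /restr; case: pickP => [s _|_]; last by rewrite mulr0.
by rewrite rmorphM /= permw_const.
Qed.

Lemma permw_psum s i r : in_Sv s -> permw s (psum k v i r) = psum k v i r.
Proof.
move=> hs; rewrite /psum rmorph_sum [RHS](reindex_inj (@perm_inj _ s)) /=.
apply: eq_big => [t|t _]; first by rewrite tag_in_Sv.
by rewrite rmorphXn /= permw_var.
Qed.

(** A generator of [psum_alg] in the variables of [A] is absorbed into [q]; a power sum is
    $S_{\mathbf v}$-invariant and comes out as a left factor. *)
Lemma orbsum_psum_alg A g p : psum_alg A g ->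
  (forall q, polys_in A q -> QF_alg (orbsum A (q * p))) ->
  forall q, polys_in A q -> QF_alg (orbsum A (q * (g * p))).
Proof.
move=> hg; elim: hg p => [|x hx|x y _ IHx _ IHy|x y _ IHx _ IHy] p hp q hq.
- by rewrite mul1r; exact: hp.
- have: polys_in A x \/ exists i r, (0 < r)%N /\ x = psum k v i r.
    case: hx => [hx|[i _ [r r0 <-]]]; last by right; exists i, r.
    by left; exact: subring_gen_in.
  case=> [hx'|[i [r [r0 ->]]]].
    by rewrite mulrA; apply: hp; exact: subring_genM.
  rewrite mulrCA -orbsum_wpoly => [|s hs]; last exact: permw_psum.
  by apply: subring_genM; [exact: QF_psum|exact: hp].
- have -> : q * ((x - y) * p) = q * (x * p) - q * (y * p) by rewrite mulrBl mulrBr.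
  by rewrite raddfB; apply: subring_genB; [exact: IHx|exact: IHy].
have -> : x * y * p = x * (y * p) by exact/esym/mulrA.
exact: (IHx _ (IHy p hp) q hq).
Qed.

Section Corner.
Variables (m : vertex Q -> nat) (mv : forall i, (m i <= v i)%N).

Definition widen (t : windex m) : J :=
  Tagged (fun i => 'I_(v i)) (widen_ord (mv (tag t)) (tagged t)).

Lemma widen_inj : injective widen.
Proof.
move=> [i r] [i' r'] e; have ei : i = i' by have := congr1 tag e.
subst i'; move/eqP: e; rewrite eq_Tagged /= => /eqP e.
by congr existT; apply: val_inj; have := congr1 val e.
Qed.

Lemma widen_corner : widen @: [set: windex m]%SET = corner v m.
Proof.
apply/setP => -[i r]; rewrite !inE /=; apply/imsetP/idP => [[[i' r'] _ e]|rm].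
  have ei : i = i' by have := congr1 tag e.
  subst i'; move/eqP: e; rewrite eq_Tagged /= => /eqP ->.
  exact: (ltn_ord r').
exists (Tagged (fun i => 'I_(m i)) (Ordinal rm)) => //.
by congr existT; apply: val_inj.
Qed.

(** Induction on membership in the ideal, for all [f] at once: after renaming, the ideal
    coefficients are polynomials in the corner variables and are absorbed into [f]. *)
Lemma orbsum_ideal (h : R) (f : wpoly) :
  ideal_gen (ordprod (@tag _ _) (@pconst R (windex m)) (@pvar R (windex m)) @`
    orderings finset.setT) (pconst _ h) ->
  psum_alg (corner v m) f -> QF_alg (orbsum (corner v m) (f * pconst _ h)).
Proof.
rewrite -(prename_const widen) => hh.
elim: hh f => [|_ [ts [us ts_all] <-]|x y _ IHx _ IHy|a x _ IH] f hf.
- by rewrite rmorph0 mulr0 raddf0; exact: subring_gen0.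
- rewrite (ordprod_morph (col' := @tag _ _) (c' := @pconst R J) (x' := w)
    (e := widen)); first last.
  + by move=> t; exact: prename_var.
  + by move=> r; exact: prename_const.
  + by [].
  + exact: widen_inj.
  rewrite -[f * _]mul1r; apply: orbsum_psum_alg => //; last exact: subring_gen1.
  have ec : corner v m = [set a in map widen ts]%SET.
    by rewrite imset_map_set ts_all widen_corner.
  rewrite ec => q hq; apply: (QF_orbsum_ordprod rat_to_k) => //.
  by rewrite map_inj_uniq //; exact: widen_inj.
- by rewrite rmorphD mulrDr raddfD; apply: subring_genD; [exact: IHx|exact: IHy].
rewrite rmorphM mulrA; apply: IH; apply: subring_genM => //.
by apply: psum_alg_polys; rewrite -widen_corner; exact: prename_polys_in.
Qed.

(** Permutations fixing the corner pointwise fix [f], so [fixed_psum_alg] applies; the orbit sum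
    then equals the monopole operator times the order of the stabilizer. *)
Lemma QF_monopole (h : R) (f : wpoly) :
  ideal_gen (ordprod (@tag _ _) (@pconst R (windex m)) (@pvar R (windex m)) @`
    orderings finset.setT) (pconst _ h) ->
  Lambda1 m f -> QF_alg (monopole m (pconst _ h * f)).
Proof.
move=> hh Lf; apply: (QF_divn rat_to_k (corner_stab_gt0 v m)).
rewrite -orbsum_monopole //; last first.
  by move=> s hs hc; rewrite rmorphM /= permw_const Lf.
rewrite mulrC; apply: orbsum_ideal => //.
apply: (fixed_psum_alg rat_to_k) => s /fixpermP[hs sA].
by apply: Lf => //; exact: imset_fix.
Qed.

End Corner.

Lemma homogeneous_monopole m (f : wpoly) : homogeneous m (monopole m f).
Proof.
move=> a; rewrite /monopole raddf_sum /= => ha i.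
have [G /andP[hG]] : exists G, has_size m G && (indic G == a).
  apply/existsP; apply: contraNT ha; rewrite negb_exists => /forallP h.
  apply/eqP; apply: big1 => G hG; rewrite mcoeffU.
  by have := h G; rewrite hG /= => /negbTE ->.
move=> /eqP <-; rewrite -(eqP (forallP hG i)) -sum1_card.
rewrite [RHS](eq_bigl (fun j => (tag j == i) && (j \in G))).
  by rewrite [RHS]big_mkcondr; apply: eq_bigr => j _; rewrite ffunE; case: (j \in G).
by move=> j; rewrite inE andbC.
Qed.

Lemma zastava_deg_monopole m (f : wpoly) :
  (forall i, (m i <= v i)%N) -> Lambda1 m f -> zastava_deg k v m (monopole m f).
Proof.
move=> mv Lf; split; last exact: homogeneous_monopole.
by apply: subring_gen_in; exists m, f.
Qed.

Lemma zastava_deg_wpoly p : Lambda1 (fun=> 0%N) p ->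
  zastava_deg k v (fun=> 0%N) (of_wpoly p).
Proof. by move=> Lp; rewrite -monopole0 //; exact: zastava_deg_monopole. Qed.

Lemma zastava_deg_base c : zastava_deg k v (fun=> 0%N) (of_base v c).
Proof. by apply: zastava_deg_wpoly => s _ _; exact: permw_const. Qed.

Lemma zastava_deg_Q i r : zastava_deg k v (fun=> 0%N) (elemQ k v i r).
Proof.
apply: zastava_deg_wpoly => s hs _.
pose F (t : J) : {poly wpoly} := 1 - (w t)%:P * 'X.
(* Indexed by the points of colour [i], the product is visibly invariant: permutations only reindex
   it. *)
have prodE : \prod_(j < v i) F (Tagged (fun i => 'I_(v i)) j) = \prod_(t | tag t == i) F t.
  transitivity (\prod_(i' | i' == i) \prod_(j < v i') F (Tagged (fun i => 'I_(v i)) j)).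
    by rewrite big_pred1_eq.
  rewrite sig_big_dep /=; apply: eq_big => [[i' j]|[i' j] _] //=.
  by rewrite andbT.
have FS t : map_poly (permw s) (F t) = F (s t).
  by rewrite /F rmorphB rmorph1 rmorphM /= map_polyX map_polyC /= permw_var.
have FSprod : map_poly (permw s) (\prod_(t | tag t == i) F t) = \prod_(t | tag t == i) F t.
  rewrite rmorph_prod [RHS](reindex_inj (@perm_inj _ s)) /=.
  by apply: eq_big => [t|t _]; [rewrite tag_in_Sv|exact: FS].
rewrite [\prod_(j < v i) _]prodE.
transitivity ((map_poly (permw s) (\prod_(t | tag t == i) F t))`_r); first by rewrite coef_map.
by rewrite FSprod.
Qed.

Lemma alpha_le t i : (alpha (tag t) i <= v i)%N.
Proof.
rewrite /alpha; case: eqP => // ->; exact: leq_trans (ltn_ord (tagged t)).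
Qed.

Lemma zastava_deg_F i r : zastava_deg k v (alpha i) (elemF k v i r).
Proof.
rewrite /elemF; case: insubP => [s _ s0|_]; last first.
  (* For $v_i=0$ the element is 0, which is homogeneous of every degree. *)
  split; first exact: subring_gen0.
  by move=> a; rewrite mcoeff0 eqxx.
pose t : J := Tagged (fun i => 'I_(v i)) (s : 'I_(v i)).
apply: zastava_deg_monopole; first exact: (alpha_le t).
exact: (@Lambda1_alphaX k Q v t).
Qed.

Lemma QF_spherical x : QF_alg x -> spherical_subalgebra (zastava_deg k v) x.
Proof.
apply: subring_gen_sub => y [[c _ <-]|[i [r [_ [->|->]]]]]; apply: subring_gen_in.
- by left; exact: zastava_deg_base.
- by left; exact: zastava_deg_Q.
by right; exists i => //; exact: zastava_deg_F.
Qed.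

End Fundamental.

(** * Subrings of central localizations *)

Section LocalizedSubrings.
Variables (A : pzRingType) (S : central_multset A).
Implicit Types (X : set A) (Y : set (loc S)).

(** Bringing fractions to a common denominator multiplies numerators by elements of [S], which
    therefore must lie in the subring. *)
Lemma loc_set_subring X Y :
  S `<=` subring_gen X -> Y `<=` loc_set S (subring_gen X) ->
  subring_gen Y `<=` loc_set S (subring_gen X).
Proof.
move=> SX YX y; elim=> [|z /YX //|x z _ [a [s [Xa ->]]] _ [b [t [Xb ->]]]|
    x z _ [a [s [Xa ->]]] _ [b [t [Xb ->]]]].
- by exists 1, (den1 S); split => //; exact: subring_gen1.
- have Xs : subring_gen X (val s) by apply: SX; exact: set_valP.
  have Xt : subring_gen X (val t) by apply: SX; exact: set_valP.
  exists (val t * a - val s * b), (denM s t); split.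
    by apply: subring_genB; exact: subring_genM.
  by rewrite fracN fracD mulrN.
by exists (a * b), (denM s t); split; [exact: subring_genM|rewrite fracM].
Qed.

Lemma to_loc_gen X Y x : (forall y, X y -> subring_gen Y (to_loc S y)) ->
  subring_gen X x -> subring_gen Y (to_loc S x).
Proof.
move=> XY; elim=> [|y /XY//|y z _ hy _ hz|y z _ hy _ hz].
- by rewrite rmorph1; exact: subring_gen1.
- by rewrite rmorphB; exact: subring_genB.
by rewrite rmorphM; exact: subring_genM.
Qed.

Lemma loc_set_sub_gen X Y :
  (forall s, subring_gen Y (Defs.frac 1 s)) ->
  (forall x, X x -> subring_gen Y (to_loc S x)) ->
  loc_set S (subring_gen X) `<=` subring_gen Y.
Proof.
move=> YS YX _ [a [s [Xa ->]]].
have -> : Defs.frac a s = to_loc S a * Defs.frac 1 s.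
  by rewrite /to_loc fracM mulr1; congr (Defs.frac a _); apply: val_inj; rewrite /= mul1r.
by apply: subring_genM => //; exact: to_loc_gen Xa.
Qed.

Lemma to_loc_den (s : S) x : to_loc S x = Defs.frac 1 s * to_loc S (val s * x).
Proof.
rewrite /to_loc fracM; apply/fracP; exists (den1 S).
by rewrite /= !mul1r mulr1.
Qed.

End LocalizedSubrings.

Theorem theorem6p11 (k : comNzRingType) (rat_to_k : {rmorphism rat -> k})
    (Q : quiver) :
  (forall v : vertex Q -> nat,
    spherically_generated (zastava_M k v) (zastava_M_deg k v) /\
    zastava_M k v =
      subring_gen (base_M k v `|` to_loc (M_multset k v) @` elemsQF k v)) /\
  (forall m : vertex Q -> nat, exists2 h : base_ring k Q, Mset h &
    forall v : vertex Q -> nat, (forall i, (m i <= v i)%N) ->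
    forall f : pring (base_ring k Q) (windex v), Lambda1 m f ->
    [/\ of_base v h * monopole m f = monopole m (pconst _ h * f),
        spherical_subalgebra (zastava_deg k v)
          (monopole m (pconst _ h * f)) &
        subring_gen (range (of_base v) `|` elemsQF k v)
          (monopole m (pconst _ h * f))]).
Proof.
(* The ordered products live on the points of [m] alone, so [h] is found before any [v] is given. *)
have ideal_m (m : vertex Q -> nat) : exists2 h : base_ring k Q, Mset h &
    ideal_gen (ordprod (@tag _ _) (@pconst (base_ring k Q) (windex m))
      (@pvar (base_ring k Q) (windex m)) @` orderings finset.setT) (pconst _ h).
  have [_ [h Mh <-] hh] := ordprod_meets (@tag _ _) (@pconst (base_ring k Q) (windex m))
    (@pvar (base_ring k Q) (windex m)) finset.setT.
  by exists h.
split=> [v|m]; last first.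
  have [h Mh hh] := ideal_m m; exists h => // v mv f Lf.
  have QFh := QF_monopole rat_to_k mv hh Lf.
  by split; [exact: monopole_scale|exact: QF_spherical|].
have M_zastava : M_multset k v `<=` zastava k v.
  by move=> _ [h _ <-]; have [] := zastava_deg_base v h.
(* Common core of both generation statements: after localization a monopole operator is $1/h$ times
   an element of [QF_alg]. *)
have sub_gen (Y : set (loc (M_multset k v))) :
    (forall s, subring_gen Y (Defs.frac 1 s)) ->
    (forall x, QF_alg x -> subring_gen Y (to_loc _ x)) -> zastava_M k v `<=` subring_gen Y.
  move=> YS YQF; apply: loc_set_sub_gen => // _ [m [f [mv Lf ->]]].
  have [h Mh hh] := ideal_m m.
  have Sh : cms_set (M_multset k v) (of_base v h) by exists h.
  rewrite (to_loc_den (SigSub (mem_set Sh))) /= monopole_scale.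
  by apply: subring_genM => //; apply: YQF; exact: QF_monopole.
have one_deg0 : zastava_deg k v (fun=> 0%N) 1.
  by have := zastava_deg_base (k := k) v 1; rewrite /of_base !rmorph1.
split; apply/seteqP; split.
- apply: sub_gen => [s|x /QF_spherical].
    (* The inverse of a denominator is itself a fraction with numerator 1 of degree $\mathbf 0$. *)
    by apply: subring_gen_in; left; exists 1, s.
  apply: to_loc_gen => y hy; apply: subring_gen_in.
  by case: hy => [hy|[i _ hy]]; [left|right; exists i => //]; exists y, (den1 _).
- apply: loc_set_subring => // y [hy|[i _ hy]]; case: hy => a [s [[Za _] ->]]; by exists a, s.
- apply: sub_gen => [s|x].
    by apply: subring_gen_in; left; exists 1, s; split => //; exists 1; rewrite // /of_base !rmorph1.
  apply: to_loc_gen => y [[c _ <-]|hy]; apply: subring_gen_in.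
    by left; exists (of_base v c), (den1 _).
  by right; exists y.
- apply: loc_set_subring => // y [[a [s [[c _ <-] ->]]]|[x hx <-]].
    by exists (of_base v c), s; split => //; have [] := zastava_deg_base v c.
  exists x, (den1 _); split => //.
  case: hx => i [r [_ [->|->]]].
    by have [] := zastava_deg_Q k v i r.
  by have [] := zastava_deg_F k v i r.
Qed.
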